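(* Let $A,B\in\mathbb{R}$ with $A<B$ and let $0<p<1$. Let $X$ be any one of the spaces $H^p$, $H^p_{[A,B]}$, or $\bigcap_{s<1}H^s_{[A,B]}$. Then the set $\{f\in X:\beta(f)\notin\ell^\infty\}$ is a $G_\delta$ and dense subset of $X$, and for every $n\in\mathbb{N}$ the set $\{f\in X:\beta(f^{(n)})\notin\ell^\infty\}$ is a $G_\delta$ and dense subset of $X$.
   Context: $\mathbb{D}$ is the open unit disc in $\mathbb{C}$. For $0<p<1$, $H^p$ is the set of holomorphic $f:\mathbb{D}\to\mathbb{C}$ with $\sup_{0<r<1}\frac{1}{2\pi}\int_0^{2\pi}|f(re^{i\theta})|^p\,d\theta<+\infty$, with metric $d_p(f,g)=\sup_{0<r<1}\frac{1}{2\pi}\int_0^{2\pi}|f(re^{i\theta})-g(re^{i\theta})|^p\,d\theta$. For real $A<B$ and $0<p<1$, $H^p_{[A,B]}$ is the set of holomorphic $f:\mathbb{D}\to\mathbb{C}$ with $\sup_{0<r<1}\int_A^B|f(re^{i\theta})|^p\frac{d\theta}{B-A}<+\infty$, with metric $$d_{p,[A,B]}(f,g)=\sup_{0<r<1}\int_A^B|f(re^{i\theta})-g(re^{i\theta})|^p\frac{d\theta}{B-A}+\sum_{n=2}^\infty\frac{1}{2^n}\frac{\sup_{|z|\le 1-\frac1n}|f(z)-g(z)|}{1+\sup_{|z|\le 1-\frac1n}|f(z)-g(z)|}.$$ The space $\bigcap_{s<1}H^s_{[A,B]}$ (intersection over $0<s<1$) carries the metric $d(f,g)=\sum_{n=1}^\infty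 2^{-n}\frac{d_{p_n,[A,B]}(f,g)}{1+d_{p_n,[A,B]}(f,g)}$, where $(p_n)$ is any strictly increasing sequence in $(0,1)$ converging to $1$; equivalently, convergence in it is convergence in $H^s_{[A,B]}$ for every $0<s<1$. For a holomorphic function $g$ on $\mathbb{D}$, $\beta(g)=(\beta_k(g))_{k=0}^\infty$ is the sequence of its Taylor coefficients at $0$, i.e. $g(z)=\sum_{k\ge 0}\beta_k(g)z^k$; $f^{(n)}$ denotes the $n$-th complex derivative of $f$. $\ell^\infty$ is the set of bounded complex sequences. *)

(* Defs.v *)
From HB Require Import structures.
From mathcomp Require Import all_boot all_order all_algebra.
From mathcomp Require Import all_classical all_reals all_analysis.
From mathcomp Require Import complex.

Set Implicit Arguments.
Unset Strict Implicit.
Unset Printing Implicit Defensive.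

Import Order.TTheory GRing.Theory Num.Theory.
Import numFieldNormedType.Exports.

Local Open Scope complex_scope.
Local Open Scope ring_scope.
Local Open Scope classical_set_scope.

(* Nothing is required of [d] here; when [d] restricts to a metric on [X],
   this is the metric space ([X], [d]). *)
Definition dist_space (R : realType) (T : Type) (X : set T) (d : T -> T -> R) :
  Type := {x : T | X x}.

Section dist_topology.
Context (R : realType) (T : Type) (X : set T) (d : T -> T -> R).
Local Notation S := (dist_space X d).

Definition dist_open (U : set S) : Prop :=
  forall x : S, U x -> exists2 e : R, 0 < e &
    forall y : S, d (sval x) (sval y) < e -> U y.

Let dist_openT : dist_open setT.
Proof. by move=> x _; exists 1. Qed.

Let dist_openI : setI_closed dist_open.
Proof.
move=> U V oU oV x [/oU[e e0 eU] /oV[e' e'0 eV]].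
exists (Num.min e e'); first by rewrite lt_min e0.
by move=> y; rewrite lt_min => /andP[/eU Uy /eV Vy]; split.
Qed.

Let dist_open_bigU (I : Type) (F : I -> set S) :
  (forall i, dist_open (F i)) -> dist_open (\bigcup_i F i).
Proof.
move=> oF x [i _ /(oF i)[e e0 eF]]; exists e => // y /eF Fy.
by exists i.
Qed.

HB.instance Definition _ := gen_eqMixin S.
HB.instance Definition _ := gen_choiceMixin S.
HB.instance Definition _ :=
  isOpenTopological.Build S dist_openT dist_openI dist_open_bigU.

End dist_topology.

(* The topology and the normed module structure are attached to an abstract
   [numFieldType], hence this packaging of [R[i]]. *)
Definition cplx (R : realType) : numFieldType := R[i].

Section holomorphic.
Context (R : realType).
Local Notation C := (cplx R).
Implicit Types (f g : C -> C) (u : nat -> C).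

Definition unit_disc : set C := [set z : C | `|z| < 1].

(* A function on the disc is represented by its extension by 0 to the whole
   plane, so that Leibniz equality is equality on the disc. *)
Definition holo_disc : set (C -> C) :=
  [set f : C -> C | (forall z, unit_disc z -> derivable f z 1) /\
                    (forall z, ~ unit_disc z -> f z = 0)].

Definition taylor_coef f : nat -> C := fun k => derive1n k f 0 / k`!%:R.

Definition ell_infty : set (nat -> C) := [set u : nat -> C | bounded_fun u].

End holomorphic.

Section hardy.
Context (R : realType).
Local Notation C := (cplx R).
Local Notation normc := Normc.normc.
Implicit Types (f g h : C -> C) (p A B r : R) (n : nat).

Definition polar r (t : R) : C := r%:C * (cos t +i* sin t).

Definition arc_mean p A B r h : \bar R :=
  ((B - A)^-1%:E *
   \int[lebesgue_measure]_(t in `[A, B]) (normc (h (polar r t)) `^ p)%:E)%E.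

Definition arc_sup p A B h : \bar R :=
  ereal_sup [set arc_mean p A B r h | r in [set r : R | 0 < r < 1]].

Definition Hp p : set (C -> C) :=
  [set f | holo_disc f /\ (arc_sup p 0 (2 * pi) f < +oo)%E].

(* The suprema are finite on the spaces considered, where [fine] and [sup]
   therefore return their actual values. *)
Definition dist_Hp p f g : R := fine (arc_sup p 0 (2 * pi) (f \- g)).

Definition HpAB p A B : set (C -> C) :=
  [set f | holo_disc f /\ (arc_sup p A B f < +oo)%E].

Definition disc_sup n h : R :=
  sup [set normc (h z) | z in [set z : C | normc z <= 1 - n%:R^-1]].

Definition dist_HpAB p A B f g : R :=
  fine (arc_sup p A B (f \- g)) +
  \big[+%R/0]_(2 <= n <oo)
    (2 ^- n * (disc_sup n (f \- g) / (1 + disc_sup n (f \- g)))).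

Definition capHAB A B : set (C -> C) :=
  [set f | forall s : R, 0 < s < 1 -> HpAB s A B f].

(* The sequence of exponents is indexed from 0: [q n] is $p_{n+1}$. *)
Definition dist_capHAB (q : nat -> R) A B f g : R :=
  \big[+%R/0]_(0 <= n <oo)
    (2 ^- n.+1 * (dist_HpAB (q n) A B f g / (1 + dist_HpAB (q n) A B f g))).

End hardy.

(* Main.v *)
Require Import Defs.
From mathcomp Require Import all_boot all_order all_algebra.
From mathcomp Require Import all_classical all_reals all_analysis.
From mathcomp Require Import borel_hierarchy complex.
From mathcomp Require Import ring lra.
Import Order.TTheory GRing.Theory Num.Theory.
Import numFieldNormedType.Exports.
Local Open Scope ring_scope.
Local Open Scope classical_set_scope.
Set Implicit Arguments.
Unset Strict Implicit.
Unset Printing Implicit Defensive.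

(** The coefficients [beta_k(f^(n))] and [beta_(n+k)(f)] differ by the factor
    [(n+k)!/k! >= 1], and unboundedness of a sequence is the conjunction over
    [i : nat] of the conditions that some term exceeds [i]. So everything rests
    on two facts about each of the three spaces.

    Each functional [beta_k] is continuous, which makes these conditions open
    ([open_coef_gt]). A small distance forces a small supremum on the disc
    [|z| <= 1/4], and the estimates of Cauchy then bound the coefficients
    ([nc_taylor_coef_le]). On the arc spaces the second part of the metric
    controls this supremum. On [H^p] it is controlled by the [p]-means over
    circles, through an argument of Hardy and Littlewood ([hardy_littlewood]).

    Some [g] has unbounded coefficients and lies in [H^s] for every [s < 1]. If
    [f] has bounded coefficients then [f + c g] does not, and it tends to [f] as
    [c] tends to 0, so the set is dense ([dense_unbounded_coef]). Here
    [g z = (log (2 - z) - log (1 - z)) / (1 - z)]: its coefficients are partial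
    sums of a series comparable with the harmonic series
    ([taylor_coef_gfun_unbounded]), while [|g z| <= K_e |1 - z|^(-1-e)] for every
    [e > 0] ([nc_lam0_le]), and [|1 - r e^(it)|^(-a)] has bounded integrals for
    [0 < a < 1] ([rint_onem_polar_powR]). The same [g] serves for all spaces and all [n].

    Functions are only assumed derivable at each point of the disc, so the
    formula of Cauchy starts from the theorem of Goursat ([goursat]). Applied in
    logarithmic polar coordinates, where circles are segments, it shows that the
    integral of a holomorphic function over a circle centred at 0 does not depend
    on the radius ([circle_int_const]). Applied to
    [z (h z - h z0) / (z - z0)], this gives [cauchy_formula], and differentiation
    under the integral sign gives all derivatives ([derive1n_cauchy]). *)

(** * Modulus, topology and derivatives of complex functions *)

Section ComplexModulus.
Context {R : realType}.
Local Notation C := (cplx R).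
Local Notation nc := (@Normc.normc R).
Local Notation Re := (@complex.Re R).
Local Notation Im := (@complex.Im R).
Implicit Types (x y z w : C) (a b : R).

Lemma norm_nc (z : C) : `|z| = (real_complex R (nc z)) :> C.
Proof. by []. Qed.

Lemma nc_ge0 z : 0 <= nc z.
Proof. by case: z => a b; exact: sqrtr_ge0. Qed.

Lemma nc0 : nc (0 : C) = 0. Proof. exact: Normc.normc0. Qed.

Lemma nc1 : nc (1 : C) = 1. Proof. exact: Normc.normc1. Qed.

Lemma nc_eq0 z : (nc z == 0) = (z == 0).
Proof.
by apply/eqP/eqP => [/Normc.eq0_normc //|->]; exact: nc0.
Qed.

Lemma nc_gt0 z : (0 < nc z) = (z != 0).
Proof. by rewrite lt_neqAle nc_ge0 andbT eq_sym nc_eq0. Qed.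

Lemma ncM x y : nc (x * y) = nc x * nc y. Proof. exact: Normc.normcM. Qed.

Lemma ncV x : nc x^-1 = (nc x)^-1. Proof. exact: Normc.normcV. Qed.

Lemma ncX x n : nc (x ^+ n) = nc x ^+ n.
Proof. by elim: n => [|n IH]; rewrite ?nc1 // !exprS ncM IH. Qed.

Lemma ncD x y : nc (x + y) <= nc x + nc y. Proof. exact: le_normcD. Qed.

Lemma ncN x : nc (- x) = nc x. Proof. exact: normcN. Qed.

Lemma ncB x y : nc (x - y) <= nc x + nc y.
Proof. by rewrite -(ncN y) ncD. Qed.

Lemma nc_distC x y : nc (x - y) = nc (y - x).
Proof. by rewrite -ncN opprB. Qed.

Lemma ler_ncB x y : nc x - nc y <= nc (x - y).
Proof. by have := ncD (x - y) y; rewrite subrK; lra. Qed.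

Lemma ReD x y : Re (x + y) = Re x + Re y. Proof. by case: x; case: y. Qed.
Lemma ImD x y : Im (x + y) = Im x + Im y. Proof. by case: x; case: y. Qed.
Lemma ReN x : Re (- x) = - Re x. Proof. by case: x. Qed.
Lemma ImN x : Im (- x) = - Im x. Proof. by case: x. Qed.
Lemma ReM x y : Re (x * y) = Re x * Re y - Im x * Im y.
Proof. by case: x; case: y. Qed.
Lemma ImM x y : Im (x * y) = Re x * Im y + Im x * Re y.
Proof. by case: x => a b; case: y => c d /=; rewrite [b * c]mulrC. Qed.

Lemma complexP x y : Re x = Re y -> Im x = Im y -> x = y.
Proof. by case: x => a b; case: y => c d /= -> ->. Qed.

Lemma nc2 x : nc x ^+ 2 = Re x ^+ 2 + Im x ^+ 2.
Proof. by case: x => a b /=; rewrite sqr_sqrtr // addr_ge0 // sqr_ge0. Qed.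

Lemma Re_le_nc x : `|Re x| <= nc x.
Proof.
rewrite -(@ler_pXn2r _ 2) ?nnegrE ?nc_ge0 // nc2 real_normK ?num_real //.
by rewrite lerDl sqr_ge0.
Qed.

Lemma Im_le_nc x : `|Im x| <= nc x.
Proof.
rewrite -(@ler_pXn2r _ 2) ?nnegrE ?nc_ge0 // nc2 real_normK ?num_real //.
by rewrite lerDr sqr_ge0.
Qed.

Lemma nc_le_ReIm x : nc x <= `|Re x| + `|Im x|.
Proof.
rewrite -(@ler_pXn2r _ 2) ?nnegrE ?nc_ge0 ?addr_ge0 // nc2 sqrrD.
rewrite !real_normK ?num_real // lerD2r lerDl.
by rewrite mulrn_wge0 // mulr_ge0.
Qed.

(** The codomain is [cplx R] rather than [R[i]], so that the field operations of
    [cplx R] apply to the values. *)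
Definition rc a : C := (a +i* 0)%C.

Lemma rcD a b : rc (a + b) = rc a + rc b.
Proof. by apply: complexP; rewrite ?ReD ?ImD /= ?addr0. Qed.

Lemma rcN a : rc (- a) = - rc a.
Proof. by apply: complexP; rewrite ?ReN ?ImN /= ?oppr0. Qed.

Lemma rcB a b : rc (a - b) = rc a - rc b.
Proof. by rewrite rcD rcN. Qed.

Lemma rcM a b : rc (a * b) = rc a * rc b.
Proof. by apply: complexP; rewrite ?ReM ?ImM /= ?mulr0 ?mul0r ?subr0 ?addr0. Qed.

Lemma rc0 : rc 0 = 0. Proof. by []. Qed.

Lemma rc_nat n : rc n%:R = n%:R.
Proof. by elim: n => [//|n IH]; rewrite -addn1 !natrD rcD IH. Qed.

Lemma rcX a n : rc (a ^+ n) = rc a ^+ n.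
Proof. by elim: n => [//|n IH]; rewrite !exprS rcM IH. Qed.

Lemma rcV a : rc a^-1 = (rc a)^-1.
Proof.
have [->|a0] := eqVneq a 0; first by rewrite invr0 rc0 invr0.
have ra0 : rc a != 0 by apply/eqP => -[/eqP]; exact/negP.
by apply: (mulfI ra0); rewrite -rcM !divff.
Qed.

Lemma nc_rc a : nc (rc a) = `|a|.
Proof. by rewrite /= expr0n addr0 sqrtr_sqr. Qed.

Lemma nc_nat n : nc (n%:R : C) = n%:R.
Proof. by rewrite -rc_nat nc_rc ger0_norm. Qed.

Lemma nbhs_ncP (z : C) (P : set C) :
  nbhs z P <-> exists2 e : R, 0 < e & forall w, nc (w - z) < e -> P w.
Proof.
split=> [/nbhs_ballP[e /= e0 eP]|[e e0 eP]].
  move: e0; case: e eP => e e' eP; rewrite ltcE /= => /andP[/eqP e'0 e0].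
  exists e => // w we; apply: eP; rewrite -ball_normE /= norm_nc nc_distC.
  by rewrite ltcE /= e'0 eqxx.
apply/nbhs_ballP; exists (real_complex R e) => /=; first by rewrite ltcE /= eqxx.
move=> w; rewrite -ball_normE /= norm_nc nc_distC ltcE /= => /andP[_].
exact: eP.
Qed.

Lemma cvg_ncP (T : topologicalType) (F : set_system T) (FF : Filter F)
    (f : T -> C) (l : C) :
  f @ F --> l <-> forall e : R, 0 < e -> \forall t \near F, nc (f t - l) < e.
Proof.
split=> [fl e e0|H].
  by have : nbhs l [set w | nc (w - l) < e]; [apply/nbhs_ncP; exists e | move/fl].
move=> P /nbhs_ncP[e e0 eP]; rewrite /nbhs /=.
by apply: filterS (H e e0) => t /eP.
Qed.

End ComplexModulus.

Section ComplexDerivative.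
Context {R : realType}.
Local Notation C := (cplx R).
Local Notation nc := (@Normc.normc R).
Local Notation Re := (@complex.Re R).
Local Notation Im := (@complex.Im R).
Implicit Types (f g : C -> C) (z w l : C).

(** Derivability over [cplx R] in terms of the real-valued modulus, so that all
    estimates take place in [R]. *)
Definition has_cderiv f z l := forall e : R, 0 < e ->
  exists2 d : R, 0 < d & forall w, nc (w - z) < d ->
    nc (f w - f z - l * (w - z)) <= e * nc (w - z).

Lemma has_cderivP f z l :
  has_cderiv f z l <-> (fun h : C => h^-1 *: (f (h + z) - f z)) @ 0^' --> l.
Proof.
split=> [H|/cvg_ncP H].
  apply/cvg_ncP => e e0; have [d d0 Hd] := H _ (divr_gt0 e0 (ltr0n R 2)).
  rewrite near_withinE; apply/nbhs_ncP; exists d => // h hd h0.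
  rewrite subr0 in hd; have {}Hd := Hd (h + z); rewrite addrK in Hd.
  have {Hd}Hd := Hd hd.
  have -> : h^-1 *: (f (h + z) - f z) - l = h^-1 * (f (h + z) - f z - l * h).
    by rewrite mulrBr [l * h]mulrC mulKf.
  rewrite ncM ncV mulrC ltr_pdivrMr ?nc_gt0 //.
  apply: (le_lt_trans Hd); rewrite ltr_pM2r ?nc_gt0 //; lra.
move=> e e0; have := H e e0; rewrite near_withinE => /nbhs_ncP[d d0 Hd].
exists d => // w wd; have [->|wz] := eqVneq w z.
  by rewrite !subrr mulr0 subr0 nc0 mulr0.
have h0 : w - z != 0 by rewrite subr_eq0.
have := Hd (w - z); rewrite subr0 => /(_ wd h0); rewrite subrK => /ltW.
have -> : (w - z)^-1 *: (f w - f z) - l =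
    (w - z)^-1 * (f w - f z - l * (w - z)).
  by rewrite mulrBr [l * (w - z)]mulrC mulKf.
by rewrite ncM ncV mulrC ler_pdivrMr ?nc_gt0.
Qed.

Lemma derivable_has_cderiv f z :
  derivable f z 1 <-> exists l, has_cderiv f z l.
Proof.
have E : (fun h : C => h^-1 *: (f (h + z) - f z)) =
         (fun h : C => h^-1 *: ((f \o shift z) (h *: (1 : C)) - f z)).
  by apply/funext => h /=; rewrite -[h *: 1]/(h * 1) mulr1.
split=> [/cvg_ex[l Hl]|[l /has_cderivP Hl]].
  by exists l; apply/has_cderivP; rewrite E.
by apply/cvg_ex; exists l; rewrite -E.
Qed.

Lemma has_cderiv_derive1 f z l : has_cderiv f z l -> derive1 f z = l.
Proof. by move=> /has_cderivP Hl; rewrite /derive1; by apply: cvg_lim. Qed.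

End ComplexDerivative.

(** * Integrals of complex functions over a segment *)

Section RealIntegral.
Context {R : realType}.
Implicit Types (a b c t : R) (f g : R -> R).

(** Continuity is two-sided at the endpoints too: the integrands extend beyond
    the segment. *)
Definition cont_on {T : topologicalType} a b (F : R -> T) :=
  forall t, a <= t <= b -> {for t, continuous F}.

Definition rint a b f : R := \int[lebesgue_measure]_(t in `[a, b]) f t.

Lemma cont_on_integrable a b f : cont_on a b f ->
  lebesgue_measure.-integrable `[a, b] (EFin \o f).
Proof.
move=> cf; apply: continuous_compact_integrable; first exact: segment_compact.
apply: continuous_in_subspaceT => t; rewrite inE /= in_itv /= => tab.
exact: cf.
Qed.

Lemma measurable_segment a b : measurable (`[a, b] : set (measurableTypeR R)).
Proof. exact: measurable_itv. Qed.

Lemma eq_rint a b f g : (forall t, a <= t <= b -> f t = g t) ->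
  rint a b f = rint a b g.
Proof.
by move=> fg; apply: eq_Rintegral => t; rewrite inE /= in_itv /=; exact: fg.
Qed.

Lemma rintD a b f g : cont_on a b f -> cont_on a b g ->
  rint a b (fun t => f t + g t) = rint a b f + rint a b g.
Proof.
move=> cf cg; apply: RintegralD; [exact: measurable_segment|..];
exact: cont_on_integrable.
Qed.

Lemma rintZl a b f c : cont_on a b f ->
  rint a b (fun t => c * f t) = c * rint a b f.
Proof.
move=> cf; apply: RintegralZl; first exact: measurable_segment.
exact: cont_on_integrable.
Qed.

Lemma rint_cst a b c : a <= b -> rint a b (fun=> c) = c * (b - a).
Proof.
move=> ab; rewrite /rint Rintegral_cst; last exact: measurable_segment.
have := @lebesgue_measure_itv R (Interval (BLeft a) (BRight b)); rewrite /= => ->; rewrite lte_fin; case: ltP => [//|ba].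
have -> : a = b by apply/le_anti; rewrite ab ba.
by rewrite subrr /=.
Qed.

Lemma ler_rint a b f g : cont_on a b f -> cont_on a b g ->
  (forall t, a <= t <= b -> f t <= g t) -> rint a b f <= rint a b g.
Proof.
move=> cf cg fg; apply: le_Rintegral; first exact: measurable_segment.
- exact: cont_on_integrable.
- exact: cont_on_integrable.
by move=> t /=; rewrite in_itv /=; exact: fg.
Qed.

Lemma ler_norm_rint a b f : cont_on a b f ->
  `|rint a b f| <= rint a b (fun t => `|f t|).
Proof.
move=> cf; apply: le_normr_Rintegral; first exact: measurable_segment.
exact: cont_on_integrable.
Qed.

Lemma rint_ge0 a b f : (forall t, a <= t <= b -> 0 <= f t) -> 0 <= rint a b f.
Proof.
by move=> f0; apply: Rintegral_ge0 => t /=; rewrite in_itv /=; exact: f0.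
Qed.

Lemma rint_cat a c b f : a <= c <= b -> cont_on a b f ->
  rint a b f = rint a c f + rint c b f.
Proof.
move=> /andP[ac cb] cf; rewrite /rint.
rewrite -(@Rintegral_itv_obnd_cbnd _ c); last first.
  have ci : cont_on c b f.
    by move=> t /andP[ct tb]; apply: cf; rewrite (le_trans ac ct).
  move: (cont_on_integrable ci); apply: integrableS.
  - exact: measurable_itv.
  - exact: measurable_itv.
  - by apply: subset_itvr; rewrite bnd_simp.
rewrite -(@Rintegral_itvB _ f (BLeft a) (BRight b) c) //.
- by rewrite addrC subrK.
- exact: cont_on_integrable.
Qed.

Lemma rint_FTC a b f F : a <= b -> cont_on a b f ->
  (forall t : R, a <= t <= b -> is_derive t 1 F (f t)) ->
  rint a b f = F b - F a.
Proof.
rewrite le_eqVlt => /predU1P[-> _ _|ab cf dF].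
  by rewrite subrr /rint set_itv1 Rintegral_set1.
rewrite /rint /Rintegral (@continuous_FTC2 _ f F) //.
- apply: continuous_in_subspaceT => t; rewrite inE /= in_itv /=.
  exact: cf.
- have dFd t : a <= t <= b -> derivable F t 1.
    by move=> /dF dFt; exact: ex_derive.
  have cF t : a <= t <= b -> {for t, continuous F}.
    by move=> tab; apply: differentiable_continuous; apply/derivable1_diffP/dFd.
  split.
  + by move=> t; rewrite in_itv /= => /andP[/ltW at_ /ltW tb]; apply: dFd; rewrite at_.
  + by apply: cvg_at_right_filter; apply: cF; rewrite lexx ltW.
  + by apply: cvg_at_left_filter; apply: cF; rewrite lexx ltW.
- move=> t; rewrite in_itv /= => /andP[/ltW at_ /ltW tb].
  by rewrite derive1E; apply: derive_val; apply: dF; rewrite at_.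
Qed.

End RealIntegral.

Opaque rint.

Section ComplexIntegral.
Context {R : realType}.
Local Notation C := (cplx R).
Local Notation nc := (@Normc.normc R).
Local Notation Re := (@complex.Re R).
Local Notation Im := (@complex.Im R).
Implicit Types (a b : R) (F G : R -> C) (c : C).

Definition cint a b F : C :=
  (rint a b (fun t => Re (F t)) +i* rint a b (fun t => Im (F t)))%C.

Lemma cvg_Re (T : topologicalType) (F : set_system T) (FF : Filter F)
    (f : T -> C) (l : C) : f @ F --> l -> (fun t => Re (f t)) @ F --> Re l.
Proof.
move=> /cvg_ncP H; apply/cvgrPdist_lt => e /H; apply: filterS => t.
apply: le_lt_trans; rewrite distrC.
by have := Re_le_nc (f t - l); rewrite ReD ReN.
Qed.

Lemma cvg_Im (T : topologicalType) (F : set_system T) (FF : Filter F)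
    (f : T -> C) (l : C) : f @ F --> l -> (fun t => Im (f t)) @ F --> Im l.
Proof.
move=> /cvg_ncP H; apply/cvgrPdist_lt => e /H; apply: filterS => t.
apply: le_lt_trans; rewrite distrC.
by have := Im_le_nc (f t - l); rewrite ImD ImN.
Qed.

Lemma cvg_nc (T : topologicalType) (F : set_system T) (FF : Filter F)
    (f : T -> C) (l : C) : f @ F --> l -> (fun t => nc (f t)) @ F --> nc l.
Proof.
move=> /cvg_ncP H; apply/cvgrPdist_lt => e /H; apply: filterS => t.
apply: le_lt_trans; rewrite ler_norml; apply/andP; split.
  by have := ler_ncB (f t) l; lra.
by have := ler_ncB l (f t); rewrite nc_distC.
Qed.

Lemma cvg_complex (T : topologicalType) (F : set_system T) (FF : Filter F)
    (f g : T -> R) (l m : R) : f @ F --> l -> g @ F --> m ->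
  (fun t => (f t +i* g t)%C : C) @ F --> ((l +i* m)%C : C).
Proof.
move=> /cvgrPdist_lt fl /cvgrPdist_lt gm; apply/cvg_ncP => e e0.
have e2 : 0 < e / 2 by rewrite divr_gt0.
apply: filterS2 (fl _ e2) (gm _ e2) => t fe ge.
apply: le_lt_trans (nc_le_ReIm _) _ => /=.
rewrite -[f t - l]opprB -[g t - m]opprB !normrN; lra.
Qed.

Lemma cont_on_Re a b F : cont_on a b F -> cont_on a b (fun t => Re (F t)).
Proof. by move=> cF t /cF; exact: cvg_Re. Qed.

Lemma cont_on_Im a b F : cont_on a b F -> cont_on a b (fun t => Im (F t)).
Proof. by move=> cF t /cF; exact: cvg_Im. Qed.

Lemma cont_on_nc a b F : cont_on a b F -> cont_on a b (fun t => nc (F t)).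
Proof. by move=> cF t /cF; exact: cvg_nc. Qed.

Lemma cont_onD a b F G : cont_on a b F -> cont_on a b G ->
  cont_on a b (fun t => F t + G t).
Proof. by move=> cF cG t tab; apply: cvgD; [exact: cF|exact: cG]. Qed.

Lemma cont_onM a b F G : cont_on a b F -> cont_on a b G ->
  cont_on a b (fun t => F t * G t).
Proof. by move=> cF cG t tab; apply: cvgM; [exact: cF|exact: cG]. Qed.

Lemma cont_on_cst (T : topologicalType) a b (c : T) :
  cont_on a b (fun _ : R => c).
Proof. by move=> t _; exact: cvg_cst. Qed.

Lemma cont_onV a b F : (forall t, a <= t <= b -> F t != 0) ->
  cont_on a b F -> cont_on a b (fun t => (F t)^-1).
Proof. by move=> F0 cF t tab; apply: cvgV; [exact: F0|exact: cF]. Qed.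

Lemma cont_onX a b F n : cont_on a b F -> cont_on a b (fun t => F t ^+ n).
Proof.
move=> cF; elim: n => [|n IH]; first exact: cont_on_cst.
have -> : (fun t => F t ^+ n.+1) = (fun t => F t * F t ^+ n).
  by apply/funext => t; rewrite exprS.
exact: cont_onM.
Qed.

Lemma eq_cint a b F G : (forall t, a <= t <= b -> F t = G t) ->
  cint a b F = cint a b G.
Proof.
by move=> FG; congr Complex; apply: eq_rint => t tab; rewrite FG.
Qed.

Lemma cintD a b F G : cont_on a b F -> cont_on a b G ->
  cint a b (fun t => F t + G t) = cint a b F + cint a b G.
Proof.
move=> cF cG; apply: complexP; rewrite ?ReD ?ImD /=.
  under eq_rint do rewrite ReD.
  by rewrite rintD //; exact: cont_on_Re.
under eq_rint do rewrite ImD.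
by rewrite rintD //; exact: cont_on_Im.
Qed.

Lemma cintZl a b c F : cont_on a b F ->
  cint a b (fun t => c * F t) = c * cint a b F.
Proof.
move=> cF; have cR := cont_on_Re cF; have cI := cont_on_Im cF.
have cZ x f : cont_on a b f -> cont_on a b (fun t => (x : R) * f t : R).
  by move=> cf t tab; apply: cvgM; [exact: cvg_cst|exact: cf].
apply: complexP; rewrite ?ReM ?ImM /=.
  rewrite (@eq_rint _ _ _ _ (fun t => Re c * Re (F t) + (- Im c) * Im (F t))).
    by rewrite rintD ?rintZl //; [rewrite mulNr|exact: cZ|exact: cZ].
  by move=> t _; rewrite ReM mulNr.
rewrite (@eq_rint _ _ _ _ (fun t => Re c * Im (F t) + Im c * Re (F t))).
  by rewrite rintD ?rintZl //; exact: cZ.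
by move=> t _; rewrite ImM.
Qed.

Lemma cintB a b F G : cont_on a b F -> cont_on a b G ->
  cint a b (fun t => F t - G t) = cint a b F - cint a b G.
Proof.
move=> cF cG; have cN : cont_on a b (fun t => (-1) * G t).
  by apply: cont_onM cG; exact: cont_on_cst.
rewrite -[X in _ - X]mul1r -mulNr -(cintZl _ cG) -(cintD cF cN).
by apply: eq_cint => t _; rewrite mulN1r.
Qed.

Lemma cint_cst a b c : a <= b ->
  cint a b (fun=> c) = c * rc (b - a).
Proof.
move=> ab; apply: complexP; rewrite ?ReM ?ImM /= rint_cst //.
  by rewrite mulr0 subr0.
by rewrite mulr0 add0r.
Qed.

Lemma cint_cat a d b F : a <= d <= b -> cont_on a b F ->
  cint a b F = cint a d F + cint d b F.
Proof.
move=> adb cF; apply: complexP; rewrite ?ReD ?ImD /= (rint_cat adb) //.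
  exact: cont_on_Re.
exact: cont_on_Im.
Qed.

(** The factor 2 comes from bounding the real and the imaginary part
    separately. *)
Lemma nc_cint_le a b F : cont_on a b F ->
  nc (cint a b F) <= 2 * rint a b (fun t => nc (F t)).
Proof.
move=> cF; apply: le_trans (nc_le_ReIm _) _ => /=.
have cN := cont_on_nc cF.
have H f : cont_on a b f -> (forall t, `|f t| <= nc (F t)) ->
    `|rint a b f| <= rint a b (fun t => nc (F t)).
  move=> cf fF; apply: le_trans (ler_norm_rint cf) _.
  apply: ler_rint => // t tab; apply: cvg_norm; exact: cf.
have := H _ (cont_on_Re cF) (fun t => Re_le_nc _).
have := H _ (cont_on_Im cF) (fun t => Im_le_nc _).
lra.
Qed.

Lemma nc_cint_bound a b F (M : R) : a <= b -> cont_on a b F ->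
  (forall t, a <= t <= b -> nc (F t) <= M) ->
  nc (cint a b F) <= 2 * M * (b - a).
Proof.
move=> ab cF FM; apply: le_trans (nc_cint_le cF) _.
rewrite -mulrA ler_pM2l // -rint_cst //; apply: ler_rint => //.
  exact: cont_on_nc.
exact: cont_on_cst.
Qed.

End ComplexIntegral.

(** * The theorem of Goursat on rectangles *)

Section RealSequences.
Context {R : realType}.

Lemma nested_intervals (a b : nat -> R) :
  (forall n, a n <= a n.+1) -> (forall n, b n.+1 <= b n) ->
  (forall n, a n <= b n) -> exists x, forall n, a n <= x <= b n.
Proof.
move=> a_le b_ge ab.
have a_mono m n : (m <= n)%N -> a m <= a n.
  by move/subnK <-; elim: (n - m)%N => //= k IH; rewrite addSn (le_trans IH).
have b_mono m n : (m <= n)%N -> b n <= b m.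
  by move/subnK <-; elim: (n - m)%N => //= k IH; rewrite addSn (le_trans _ IH).
have a_le_b m n : a m <= b n.
  rewrite (le_trans (a_mono _ _ (leq_maxl m n))) //.
  by rewrite (le_trans (ab _)) // b_mono // leq_maxr.
exists (sup (range a)) => n; apply/andP; split.
  apply: ub_le_sup; last by exists n.
  by exists (b 0%N) => _ [m _ <-].
apply: ge_sup; first by exists (a 0%N); exists 0%N.
by move=> _ [m _ <-].
Qed.

Lemma half_pow_small (D e : R) : 0 < e -> exists n, D / 2 ^+ n < e.
Proof.
move=> e0; have [D0|D0] := leP D 0.
  by exists 0%N; rewrite expr0 divr1 (le_lt_trans D0).
have De : 0 <= D / e by rewrite ltW // divr_gt0.
exists (Num.bound (D / e)); rewrite ltr_pdivrMr ?exprn_gt0 // mulrC.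
rewrite -ltr_pdivrMr //; apply: lt_le_trans (archi_boundP De) _.
by rewrite -natrX ler_nat ltnW // ltn_expl.
Qed.

End RealSequences.

Section Goursat.
Context {R : realType}.
Local Notation C := (cplx R).
Local Notation nc := (@Normc.normc R).
Local Notation Re := (@complex.Re R).
Local Notation Im := (@complex.Im R).
Local Notation pt := (fun s t : R => (s +i* t)%C : C).
Local Notation "'ii'" := ((0 +i* 1)%C : C).
Implicit Types (f F G : C -> C) (z w l : C) (a b c d s : R).

Lemma has_cderiv_continuous f z l : has_cderiv f z l -> {for z, continuous f}.
Proof.
move=> H; apply: (proj2 (@cvg_ncP R _ (nbhs z) _ f (f z))) => e e0.
have [d d0 Hd] := H 1 ltr01.
have L0 : 0 < 1 + nc l by have := nc_ge0 l; lra.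
apply/nbhs_ncP; exists (Num.min d (e / (1 + nc l))).
  by rewrite lt_min d0 divr_gt0.
move=> w; rewrite lt_min ltr_pdivlMr // => /andP[/Hd wd we].
have := ncD (f w - f z - l * (w - z)) (l * (w - z)).
rewrite subrK ncM; nra.
Qed.

Lemma continuous_pt (s t : R) :
  {for s, continuous (fun s => pt s t)} /\ {for t, continuous (fun t => pt s t)}.
Proof.
by split; apply: cvg_complex; try exact: cvg_id; exact: cvg_cst.
Qed.

Definition rect_int F a b c d : C :=
  cint a b (fun s => F (pt s c)) + ii * cint c d (fun t => F (pt b t))
  - cint a b (fun s => F (pt s d)) - ii * cint c d (fun t => F (pt a t)).

Definition rect_cont F a b c d := forall s t,
  a <= s <= b -> c <= t <= d -> {for pt s t, continuous F}.

Lemma continuous_comp_curve (g : R -> C) F (t : R) :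
  {for t, continuous g} -> {for g t, continuous F} ->
  {for t, continuous (fun x => F (g x))}.
Proof. exact: continuous_comp. Qed.

Lemma rect_cont_h F a b c d t : rect_cont F a b c d -> c <= t <= d ->
  cont_on a b (fun s => F (pt s t)).
Proof.
move=> cF tcd s sab /=.
exact: (continuous_comp_curve (proj1 (continuous_pt s t)) (cF s t sab tcd)).
Qed.

Lemma rect_cont_v F a b c d s : rect_cont F a b c d -> a <= s <= b ->
  cont_on c d (fun t => F (pt s t)).
Proof.
move=> cF sab t tcd /=.
exact: (continuous_comp_curve (proj2 (continuous_pt s t)) (cF s t sab tcd)).
Qed.

Lemma rect_int_split_h F a b c d m : a <= m <= b -> c <= d ->
  rect_cont F a b c d ->
  rect_int F a b c d = rect_int F a m c d + rect_int F m b c d.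
Proof.
move=> amb cd cF; rewrite /rect_int.
rewrite (cint_cat amb (rect_cont_h cF _)) ?lexx //.
rewrite (cint_cat amb (rect_cont_h cF _)) ?lexx ?cd //.
ring.
Qed.

Lemma rect_int_split_v F a b c d m : c <= m <= d -> a <= b ->
  rect_cont F a b c d ->
  rect_int F a b c d = rect_int F a b c m + rect_int F a b m d.
Proof.
move=> cmd ab cF; rewrite /rect_int.
rewrite (cint_cat cmd (rect_cont_v cF _)) ?lexx ?ab //.
rewrite (cint_cat cmd (rect_cont_v cF _)) ?lexx ?ab //.
ring.
Qed.

Lemma rect_contW F a b c d a' b' c' d' :
  a <= a' -> b' <= b -> c <= c' -> d' <= d ->
  rect_cont F a b c d -> rect_cont F a' b' c' d'.
Proof.
move=> aa bb cc dd cF s t /andP[as_ sb] /andP[ct td]; apply: cF.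
  by rewrite (le_trans aa as_) (le_trans sb bb).
by rewrite (le_trans cc ct) (le_trans td dd).
Qed.

Lemma cint_id a b : a <= b ->
  cint a b (fun s => rc s) = rc ((b ^+ 2 - a ^+ 2) / 2).
Proof.
move=> ab; apply: complexP => /=; last by rewrite rint_cst // mul0r.
have dF t : a <= t <= b ->
    is_derive t 1 ((2^-1 : R) \*: ((@id R) ^+ 2)) (id t : R).
  move=> _; apply: is_derive_eq.
  by rewrite /= expr1 /GRing.scale /= mulr1 mulKf.
rewrite (rint_FTC ab _ dF); last by move=> t _; exact: cvg_id.
by rewrite /= exprfctE /GRing.scale /= -mulrBr mulrC.
Qed.

(** Affine functions have primitives, which are made explicit on each side. *)
Lemma rect_int_affine a b c d (u l : C) : a <= b -> c <= d ->
  rect_int (fun w => u + l * w) a b c d = 0.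
Proof.
move=> ab cd.
have cR x y : cont_on x y (fun s : R => rc s).
  move=> s _; exact: (proj1 (continuous_pt s 0)).
have cL x y v m : x <= y -> cint x y (fun s => v + m * rc s) =
    v * rc (y - x) + m * rc ((y ^+ 2 - x ^+ 2) / 2).
  move=> xy; rewrite cintD; first by rewrite cint_cst // cintZl // cint_id.
    exact: cont_on_cst.
  by apply: cont_onM => //; exact: cont_on_cst.
have cH t : cint a b (fun s => u + l * pt s t) =
    (u + l * pt 0 t) * rc (b - a)
     + l * rc ((b ^+ 2 - a ^+ 2) / 2).
  rewrite -cL //; apply: eq_cint => s _.
  rewrite -addrA -mulrDr; congr (_ + _ * _).
  by apply: complexP; rewrite ?ReD ?ImD /= ?add0r ?addr0.
have cV s : cint c d (fun t => u + l * pt s t) =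
    (u + l * rc s) * rc (d - c)
     + (l * ii) * rc ((d ^+ 2 - c ^+ 2) / 2).
  rewrite -cL //; apply: eq_cint => t _.
  rewrite -addrA -mulrA -mulrDr; congr (_ + _ * _).
  by apply: complexP; rewrite ?ReD ?ImD ?ReM ?ImM /= ?mul0r ?mul1r ?add0r ?addr0 ?subrr ?subr0.
rewrite /rect_int !cH !cV.
have pE t : pt 0 t = ii * rc t.
  by apply: complexP; rewrite ?ReM ?ImM /= ?mul0r ?mul1r ?subr0 ?add0r ?addr0.
rewrite (pE c) (pE d) !rcM !rcB !rcX; ring.
Qed.

End Goursat.

Section GoursatTheorem.
Context {R : realType}.
Local Notation C := (cplx R).
Local Notation nc := (@Normc.normc R).
Local Notation Re := (@complex.Re R).
Local Notation Im := (@complex.Im R).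
Local Notation pt := (fun s t : R => (s +i* t)%C : C).
Local Notation "'ii'" := ((0 +i* 1)%C : C).
Implicit Types (f F G : C -> C) (z w l : C) (a b c d s : R).

Lemma rect_intB F G a b c d : a <= b -> c <= d ->
  rect_cont F a b c d -> rect_cont G a b c d ->
  rect_int (fun w => F w - G w) a b c d =
  rect_int F a b c d - rect_int G a b c d.
Proof.
move=> ab cd cF cG; rewrite /rect_int.
rewrite !cintB.
- ring.
- by apply: (rect_cont_v cF); rewrite lexx.
- by apply: (rect_cont_v cG); rewrite lexx.
- by apply: (rect_cont_h cF); rewrite lexx cd.
- by apply: (rect_cont_h cG); rewrite lexx cd.
- by apply: (rect_cont_v cF); rewrite lexx ab.
- by apply: (rect_cont_v cG); rewrite lexx ab.
- by apply: (rect_cont_h cF); rewrite lexx cd.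
- by apply: (rect_cont_h cG); rewrite lexx cd.
Qed.

Lemma nc_ii : nc ii = 1.
Proof. by rewrite /= expr0n add0r expr1n sqrtr1. Qed.

Lemma nc_rect_int F a b c d (M : R) : a <= b -> c <= d ->
  rect_cont F a b c d ->
  (forall s t, a <= s <= b -> c <= t <= d -> nc (F (pt s t)) <= M) ->
  nc (rect_int F a b c d) <= 4 * M * ((b - a) + (d - c)).
Proof.
move=> ab cd cF FM.
have H t : c <= t <= d -> nc (cint a b (fun s => F (pt s t))) <= 2 * M * (b - a).
  move=> tcd; apply: nc_cint_bound => //; first exact: rect_cont_h tcd.
  by move=> s sab; exact: FM.
have V s : a <= s <= b ->
    nc (ii * cint c d (fun t => F (pt s t))) <= 2 * M * (d - c).
  move=> sab; rewrite ncM nc_ii mul1r.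
  apply: nc_cint_bound => //; first exact: rect_cont_v sab.
  by move=> t tcd; exact: FM.
have := H c; have := H d; have := V a; have := V b; rewrite !lexx ab cd /rect_int.
move=> /(_ isT); set x := (ii * _) => Hx.
move=> /(_ isT); set y := (ii * _) => Hy.
move=> /(_ isT); set u := (cint _ _ _) => Hu.
move=> /(_ isT); set v := (cint _ _ _) => Hv.
have := ncB (v + x - u) y; have := ncB (v + x) u; have := ncD v x; lra.
Qed.

Lemma continuous_affine (u l z : C) : {for z, continuous (fun w : C => u + l * w)}.
Proof.
have h1 : {for z, continuous (fun _ : C => u)} := @cst_continuous C C u z.
have h2 : {for z, continuous (fun _ : C => l)} := @cst_continuous C C l z.
have h3 : {for z, continuous (fun w : C => w)} := cvg_id.
exact: (cvgD h1 (cvgM h2 h3)).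
Qed.

Lemma nc_pt s t : nc (pt s t) <= `|s| + `|t|.
Proof. exact: nc_le_ReIm. Qed.

(** The derivative at one point of a rectangle controls its boundary integral,
    because the affine part of [F] integrates to 0. *)
Lemma rect_int_local F a b c d s0 t0 l (e : R) :
  a <= s0 <= b -> c <= t0 <= d -> 0 <= e -> rect_cont F a b c d ->
  (forall s t, a <= s <= b -> c <= t <= d ->
     nc (F (pt s t) - F (pt s0 t0) - l * (pt s t - pt s0 t0))
       <= e * nc (pt s t - pt s0 t0)) ->
  nc (rect_int F a b c d) <= 4 * e * ((b - a) + (d - c)) ^+ 2.
Proof.
move=> s0ab t0cd e0 cF H; set w0 := pt s0 t0.
have /andP[as0 s0b] := s0ab; have /andP[ct0 t0d] := t0cd.
have ab := le_trans as0 s0b; have cd := le_trans ct0 t0d.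
pose A := fun w : C => (F w0 - l * w0) + l * w.
have cA : rect_cont A a b c d by move=> s t _ _; exact: continuous_affine.
have -> : rect_int F a b c d = rect_int (fun w => F w - A w) a b c d.
  by rewrite rect_intB // rect_int_affine // subr0.
have cFA : rect_cont (fun w => F w - A w) a b c d.
  by move=> s t sab tcd; exact: (cvgB (cF s t sab tcd) (cA s t sab tcd)).
set D := (b - a) + (d - c).
have bnd s t : a <= s <= b -> c <= t <= d ->
    nc (F (pt s t) - A (pt s t)) <= e * D.
  move=> sab tcd.
  have -> : F (pt s t) - A (pt s t) =
      F (pt s t) - F w0 - l * (pt s t - w0) by rewrite /A; ring.
  apply: le_trans (H s t sab tcd) _; apply: ler_wpM2l => //.
  have -> : pt s t - pt s0 t0 = pt (s - s0) (t - t0) by [].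
  apply: le_trans (nc_pt _ _) _.
  move: sab tcd => /andP[s1 s2] /andP[t1 t2].
  rewrite /D lerD // ler_norml; apply/andP; split; lra.
have := nc_rect_int ab cd cFA bnd; rewrite -/D; lra.
Qed.

(* A rectangle, as the pair of its two sides. *)
Local Notation rect := ((R * R) * (R * R))%type.

(** One quarter of the rectangle carries at least a quarter of the integral, and
    the bound scales with the square of the half-perimeter. *)
Lemma rect_quarter F (k : R) (Q : rect) :
  let: ((a, b), (c, d)) := Q in
  a < b -> c < d -> rect_cont F a b c d ->
  k * ((b - a) + (d - c)) ^+ 2 <= nc (rect_int F a b c d) ->
  exists Q' : rect, let: ((a', b'), (c', d')) := Q' in
    [/\ [/\ a <= a', b' <= b, c <= c' & d' <= d],
        b' - a' = (b - a) / 2, d' - c' = (d - c) / 2 &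
        k * ((b' - a') + (d' - c')) ^+ 2 <= nc (rect_int F a' b' c' d')].
Proof.
case: Q => -[a b] [c d] ab cd cF kF.
pose m := (a + b) / 2; pose n := (c + d) / 2.
have amb : a <= m <= b by rewrite /m; apply/andP; split; lra.
have cnd : c <= n <= d by rewrite /n; apply/andP; split; lra.
have /andP[am mb] := amb; have /andP[cn nd] := cnd.
have c1 : rect_cont F a m c d by apply: rect_contW cF.
have c2 : rect_cont F m b c d by apply: rect_contW cF.
have E : rect_int F a b c d = rect_int F a m c n + rect_int F a m n d +
    (rect_int F m b c n + rect_int F m b n d).
  rewrite (rect_int_split_h amb (ltW cd) cF).
  by rewrite (rect_int_split_v cnd am c1) (rect_int_split_v cnd mb c2).
have k4 x y : x = (b - a) / 2 -> y = (d - c) / 2 ->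
   k * (x + y) ^+ 2 = k * ((b - a) + (d - c)) ^+ 2 / 4.
  by move=> -> ->; field.
move: kF; rewrite E; set K := k * _ => KF.
have := ncD (rect_int F a m c n + rect_int F a m n d)
            (rect_int F m b c n + rect_int F m b n d).
have := ncD (rect_int F a m c n) (rect_int F a m n d).
have := ncD (rect_int F m b c n) (rect_int F m b n d).
have l1 : m - a = (b - a) / 2 by rewrite /m; field.
have l2 : b - m = (b - a) / 2 by rewrite /m; field.
have l3 : n - c = (d - c) / 2 by rewrite /n; field.
have l4 : d - n = (d - c) / 2 by rewrite /n; field.
have [?|h1] := leP (K / 4) (nc (rect_int F a m c n)).
  by move=> _ _ _; exists ((a, m), (c, n)); rewrite k4.
have [?|h2] := leP (K / 4) (nc (rect_int F a m n d)).
  by move=> _ _ _; exists ((a, m), (n, d)); rewrite k4.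
have [?|h3] := leP (K / 4) (nc (rect_int F m b c n)).
  by move=> _ _ _; exists ((m, b), (c, n)); rewrite k4.
have [?|h4] := leP (K / 4) (nc (rect_int F m b n d)).
  by move=> _ _ _; exists ((m, b), (n, d)); rewrite k4.
move=> q1 q2 q3; exfalso; lra.
Qed.

(** Repeated quartering yields nested rectangles whose integrals remain at least
    [k] times the squared half-perimeter. At their common point, the derivative
    makes the integrals negligible with respect to that square. *)
Theorem goursat F a b c d : a < b -> c < d ->
  (forall s t, a <= s <= b -> c <= t <= d -> exists l, has_cderiv F (pt s t) l) ->
  rect_int F a b c d = 0.
Proof.
move=> ab cd dF.
have cF : rect_cont F a b c d.
  by move=> s t sab tcd; have [l /has_cderiv_continuous] := dF s t sab tcd.
apply/eqP; rewrite -nc_eq0; apply: contraT; rewrite nc_eq0 -nc_gt0 => F0.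
have D0 : 0 < (b - a) + (d - c) by lra.
pose k := nc (rect_int F a b c d) / ((b - a) + (d - c)) ^+ 2.
have k0 : 0 < k by rewrite divr_gt0 // exprn_gt0.
pose good (Q : rect) := let: ((a', b'), (c', d')) := Q in
  [/\ a' < b', c' < d', rect_cont F a' b' c' d' &
      k * ((b' - a') + (d' - c')) ^+ 2 <= nc (rect_int F a' b' c' d')].
pose half (Q Q' : rect) := let: ((a, b), (c, d)) := Q in
  let: ((a', b'), (c', d')) := Q' in
    [/\ a <= a', b' <= b, c <= c' & d' <= d] /\
     b' - a' + (d' - c') = (b - a + (d - c)) / 2.
have step (Q : {Q | good Q}) :
    {Q' : {Q' | good Q'} | half (sval Q) (sval Q')}.
  apply: cid; case: Q => -[[x y] [u v]] [xy uv cG kG].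
  have [[[x' y'] [u' v']] [inc wx wu kQ]] :=
    @rect_quarter F k ((x, y), (u, v)) xy uv cG kG.
  have gQ : good ((x', y'), (u', v')).
    split=> //; [lra|lra|].
    by case: inc => *; apply: rect_contW cG.
  by exists (exist _ _ gQ) => /=; split=> //; lra.
have g0 : good ((a, b), (c, d)).
  by split=> //; rewrite /k divfK // gt_eqF // exprn_gt0.
have [Q [Q0 Qstep]] := dependent_choice step (exist _ _ g0).
pose an n := (sval (Q n)).1.1; pose bn n := (sval (Q n)).1.2.
pose cn n := (sval (Q n)).2.1; pose dn n := (sval (Q n)).2.2.
have Qg n : [/\ an n < bn n, cn n < dn n, rect_cont F (an n) (bn n) (cn n) (dn n) &
      k * ((bn n - an n) + (dn n - cn n)) ^+ 2 <=
        nc (rect_int F (an n) (bn n) (cn n) (dn n))].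
  by rewrite /an /bn /cn /dn; case: (Q n) => -[[? ?] [? ?]].
have Qs n : [/\ an n <= an n.+1, bn n.+1 <= bn n, cn n <= cn n.+1
      & dn n.+1 <= dn n] /\
    bn n.+1 - an n.+1 + (dn n.+1 - cn n.+1) = (bn n - an n + (dn n - cn n)) / 2.
  have := Qstep n; rewrite /an /bn /cn /dn.
  by case: (Q n) => -[[? ?] [? ?]] ?; case: (Q n.+1) => -[[? ?] [? ?]] ?.
have [s0 Hs0] : exists s0, forall n, an n <= s0 <= bn n.
  apply: nested_intervals => n; first by case: (Qs n) => -[].
    by case: (Qs n) => -[].
  by case: (Qg n) => /ltW.
have [t0 Ht0] : exists t0, forall n, cn n <= t0 <= dn n.
  apply: nested_intervals => n; first by case: (Qs n) => -[].
    by case: (Qs n) => -[].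
  by case: (Qg n) => _ /ltW.
have a0 : an 0%N = a by rewrite /an Q0.
have b0 : bn 0%N = b by rewrite /bn Q0.
have c0 : cn 0%N = c by rewrite /cn Q0.
have d0 : dn 0%N = d by rewrite /dn Q0.
have w n : bn n - an n + (dn n - cn n) = (b - a + (d - c)) / 2 ^+ n.
  elim: n => [|n IH]; first by rewrite a0 b0 c0 d0 expr0 divr1.
  by rewrite (proj2 (Qs n)) IH exprSr invfM mulrA.
have [l Hl] : exists l, has_cderiv F (pt s0 t0) l.
  by apply: dF; [rewrite -a0 -b0|rewrite -c0 -d0].
have [r r0 Hr] := Hl (k / 8) (divr_gt0 k0 (ltr0n R 8)).
have [n Hn] := half_pow_small (b - a + (d - c)) r0.
have [abn cdn cn_ kn] := Qg n.
have /andP[as0 s0b] := Hs0 n; have /andP[ct0 t0d] := Ht0 n.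
have := @rect_int_local F (an n) (bn n) (cn n) (dn n) s0 t0 l (k / 8)
  (Hs0 n) (Ht0 n) (ltW (divr_gt0 k0 (ltr0n R 8))) cn_.
have -> : 4 * (k / 8) = k / 2 by field.
set D := (_ - _ + _) in kn *; have D1 : 0 < D by rewrite /D; lra.
have D2 : 0 < D ^+ 2 by rewrite exprn_gt0.
suff H : forall s t, an n <= s <= bn n -> cn n <= t <= dn n ->
  nc (pt s t - pt s0 t0) < r.
  move=> /(_ (fun s t hs ht => Hr _ (H s t hs ht))) kn'; exfalso.
  have := le_trans kn kn'; rewrite ler_pM2r //; lra.
move=> s t /andP[as_ sb] /andP[ct td]; apply: le_lt_trans Hn; rewrite -w -/D.
have -> : pt s t - pt s0 t0 = pt (s - s0) (t - t0) by [].
apply: le_trans (nc_pt _ _) _.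
rewrite /D lerD // ler_norml; apply/andP; split; lra.
Qed.

End GoursatTheorem.

(** * Calculus of derivatives, complex exponential and polar coordinates *)

Section DerivativeCalculus.
Context {R : realType}.
Local Notation C := (cplx R).
Local Notation nc := (@Normc.normc R).
Local Notation Re := (@complex.Re R).
Local Notation Im := (@complex.Im R).
Implicit Types (f g phi : C -> C) (z w l m : C).

Lemma cont_ncP f z : {for z, continuous f} <->
  forall e : R, 0 < e -> exists2 d : R, 0 < d &
    forall w, nc (w - z) < d -> nc (f w - f z) < e.
Proof.
split=> [cf e e0|H].
  exact/nbhs_ncP/(proj1 (@cvg_ncP R _ (nbhs z) _ f (f z)) cf).
apply: (proj2 (@cvg_ncP R _ (nbhs z) _ f (f z))) => e /H.
by move=> H'; apply/nbhs_ncP.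
Qed.

(** Caratheodory's form of the derivative: sums, products and composites then
    follow from the continuity of the slope functions. *)
Lemma has_cderiv_slope f z l : has_cderiv f z l ->
  exists phi, [/\ {for z, continuous phi}, phi z = l &
    forall w, f w - f z = phi w * (w - z)].
Proof.
move=> H; pose phi w := if w == z then l else (f w - f z) / (w - z).
have phiz : phi z = l by rewrite /phi eqxx.
have E w : f w - f z = phi w * (w - z).
  rewrite /phi; case: eqVneq => [->|wz]; first by rewrite !subrr mulr0.
  by rewrite divfK // subr_eq0.
exists phi; split=> //; apply/cont_ncP => e e0.
have [d d0 Hd] := H (e / 2) (divr_gt0 e0 (ltr0n R 2)).
exists d => // w /Hd; rewrite phiz E -mulrBl ncM.
have [->|wz] := eqVneq w z; first by rewrite phiz !subrr nc0.
rewrite ler_pM2r ?nc_gt0 ?subr_eq0 //; lra.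
Qed.

Lemma slope_has_cderiv f z phi (d : R) : 0 < d -> {for z, continuous phi} ->
  (forall w, nc (w - z) < d -> f w - f z = phi w * (w - z)) ->
  has_cderiv f z (phi z).
Proof.
move=> d0 /cont_ncP cphi E e e0; have [d' d'0 Hd] := cphi e e0.
exists (Num.min d d'); first by rewrite lt_min d0.
move=> w; rewrite lt_min => /andP[/E -> /Hd H].
by rewrite -mulrBl ncM ler_wpM2r ?nc_ge0 // ltW.
Qed.

Lemma has_cderiv_eq f z l m : has_cderiv f z l -> l = m -> has_cderiv f z m.
Proof. by move=> + <-. Qed.

Lemma has_cderiv_local f g z l (d : R) : 0 < d ->
  (forall w, nc (w - z) < d -> f w = g w) ->
  has_cderiv f z l -> has_cderiv g z l.
Proof.
move=> d0 fg H e e0; have [d' d'0 Hd] := H e e0.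
exists (Num.min d d'); first by rewrite lt_min d0.
move=> w; rewrite lt_min => /andP[wd /Hd].
by rewrite !fg // subrr nc0.
Qed.

Lemma has_cderiv_cst (c : C) z : has_cderiv (fun=> c) z 0.
Proof.
by move=> e e0; exists 1 => // w _; rewrite subrr mul0r subr0 nc0 mulr_ge0 ?nc_ge0 // ltW.
Qed.

Lemma has_cderiv_id z : has_cderiv (fun w => w) z 1.
Proof.
by move=> e e0; exists 1 => // w _; rewrite mul1r subrr nc0 mulr_ge0 ?nc_ge0 // ltW.
Qed.

Lemma has_cderivD f g z l m : has_cderiv f z l -> has_cderiv g z m ->
  has_cderiv (fun w => f w + g w) z (l + m).
Proof.
move=> /has_cderiv_slope[a [ca <- Ea]] /has_cderiv_slope[b [cb <- Eb]].
apply: (@slope_has_cderiv (fun w => f w + g w) z (fun w => a w + b w) 1 ltr01).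
  exact: (cvgD ca cb).
by move=> w _; rewrite mulrDl -Ea -Eb; ring.
Qed.

Lemma has_cderivM f g z l m : has_cderiv f z l -> has_cderiv g z m ->
  has_cderiv (fun w => f w * g w) z (f z * m + l * g z).
Proof.
move=> hf; have cf := has_cderiv_continuous hf; move: hf.
move=> /has_cderiv_slope[a [ca <- Ea]] /has_cderiv_slope[b [cb <- Eb]].
apply: (@slope_has_cderiv (fun w => f w * g w) z
  (fun w => f w * b w + a w * g z) 1 ltr01).
  exact: (cvgD (cvgM cf cb) (cvgM ca (@cst_continuous C C (g z) z))).
move=> w _; rewrite mulrDl -mulrA -Eb -[a w * g z * _]mulrA [g z * _]mulrC mulrA -Ea.
ring.
Qed.

Lemma has_cderivZ (c : C) f z l : has_cderiv f z l ->
  has_cderiv (fun w => c * f w) z (c * l).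
Proof.
move=> hf; apply: (has_cderiv_eq (has_cderivM (has_cderiv_cst c z) hf)); ring.
Qed.

Lemma has_cderivN f z l : has_cderiv f z l -> has_cderiv (fun w => - f w) z (- l).
Proof.
move=> /(has_cderivZ (-1)); rewrite mulN1r.
by apply: (@has_cderiv_local _ _ _ _ 1) => // w _; rewrite mulN1r.
Qed.

Lemma has_cderivB f g z l m : has_cderiv f z l -> has_cderiv g z m ->
  has_cderiv (fun w => f w - g w) z (l - m).
Proof. by move=> hf hg; exact: (has_cderivD hf (has_cderivN hg)). Qed.

Lemma has_cderivV f z l : f z != 0 -> has_cderiv f z l ->
  has_cderiv (fun w => (f w)^-1) z (- l / f z ^+ 2).
Proof.
move=> fz0 hf; have cf := has_cderiv_continuous hf; move: hf.
move=> /has_cderiv_slope[a [ca <- Ea]].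
have fz_gt : 0 < nc (f z) by rewrite nc_gt0.
have [d d0 Hd] := proj1 (cont_ncP f z) cf _ fz_gt.
have fw0 w : nc (w - z) < d -> f w != 0.
  move=> /Hd H; apply/eqP => f0; move: H; rewrite f0 sub0r ncN ltxx //.
have -> : - a z / f z ^+ 2 = - a z * ((f z)^-1 * (f z)^-1).
  by rewrite expr2 invfM.
apply: (@slope_has_cderiv _ _ (fun w => - a w * ((f w)^-1 * (f z)^-1)) d d0).
  apply: (cvgM (cvgN ca) (cvgM (cvgV fz0 cf) (@cst_continuous C C (f z)^-1 z))).
move=> w /fw0 fw; rewrite mulrAC mulNr -Ea mulrC.
by field; rewrite fz0 fw.
Qed.

Lemma has_cderiv_comp f g z l m : has_cderiv g z l -> has_cderiv f (g z) m ->
  has_cderiv (fun w => f (g w)) z (m * l).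
Proof.
move=> hg; have cg := has_cderiv_continuous hg; move: hg.
move=> /has_cderiv_slope[a [ca <- Ea]] /has_cderiv_slope[b [cb <- Eb]].
apply: (@slope_has_cderiv (fun w => f (g w)) z (fun w => b (g w) * a w) 1 ltr01).
  exact: (cvgM (continuous_comp cg cb) ca).
by move=> w _; rewrite Eb Ea mulrA.
Qed.

End DerivativeCalculus.

Section PolarCoordinates.
Context {R : realType}.
Local Notation C := (cplx R).
Local Notation nc := (@Normc.normc R).
Local Notation Re := (@complex.Re R).
Local Notation Im := (@complex.Im R).
Local Notation pt := (fun s t : R => (s +i* t)%C : C).

Lemma is_derive_local (f : R -> R) (x l e : R) : is_derive x 1 f l -> 0 < e ->
  exists2 d : R, 0 < d & forall h, `|h| < d -> `|f (h + x) - f x - l * h| <= e * `|h|.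
Proof.
move=> [/cvg_ex[l' Hl'] lE] e0.
have ll' : l = l' by rewrite -lE; apply: cvg_lim.
rewrite -{}ll' {l' lE} in Hl'.
move/cvgrPdist_le : Hl' => /(_ e e0).
rewrite near_withinE => /nbhs_ballP[d /= d0 Hd]; exists d => // h hd.
have [->|h0] := eqVneq h 0; first by rewrite add0r !subrr mulr0 subr0 normr0 mulr0.
have := Hd h; rewrite -ball_normE /= sub0r normrN => /(_ hd h0).
have -> : l - h^-1 *: (f (h *: (1 : R) + x) - f x) =
    - (h^-1 * (f (h + x) - f x - l * h)).
  by rewrite /GRing.scale /= mulr1; field.
by rewrite normrN normrM normfV mulrC ler_pdivrMr ?normr_gt0.
Qed.

(** The complex exponential, in terms of polar coordinates. *)
Definition cexp (w : C) : C := polar (expR (Re w)) (Im w).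

Lemma polarE (r t : R) : polar r t = rc r * pt (cos t) (sin t).
Proof. by []. Qed.

Lemma polar_pt (r t : R) : polar r t = pt (r * cos t) (r * sin t).
Proof. by apply: complexP; rewrite polarE ?ReM ?ImM /=; ring. Qed.

Lemma nc_polar (r t : R) : nc (polar r t) = `|r|.
Proof.
rewrite polarE ncM nc_rc.
have -> : nc (pt (cos t) (sin t)) = 1 by rewrite /= cos2Dsin2 sqrtr1.
by rewrite mulr1.
Qed.

Lemma nc_polarB (r s t : R) : nc (polar r t - polar s t) = `|r - s|.
Proof.
by rewrite !polarE -mulrBl -rcB -polarE nc_polar.
Qed.

Lemma cexpD (w v : C) : cexp (w + v) = cexp w * cexp v.
Proof.
rewrite /cexp ReD ImD expRD !polar_pt.
by apply: complexP; rewrite ?ReM ?ImM /= ?cosD ?sinD; ring.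
Qed.

(** By the multiplicativity [cexpD], the derivative at 0 determines all others. *)
Lemma has_cderiv_cexp0 : has_cderiv cexp 0 1.
Proof.
move=> e e0; pose e' := Num.min (e / 16) 1.
have e'0 : 0 < e' by rewrite lt_min ltr01 divr_gt0.
have e'1 : e' <= 1 by rewrite ge_min lexx orbT.
have e'e : e' <= e / 16 by rewrite ge_min lexx.
clearbody e'.
have [d1 d10 H1] := is_derive_local (@is_derive_expR R 0) e'0.
have [d2 d20 H2] := is_derive_local (@is_derive_cos R 0) e'0.
have [d3 d30 H3] := is_derive_local (@is_derive_sin R 0) e'0.
rewrite expR0 in H1; rewrite sin0 cos0 in H2; rewrite sin0 cos0 in H3.
exists (Num.min (Num.min d1 d2) (Num.min d3 e')).
  by rewrite !lt_min d10 d20 d30 e'0.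
move=> v; rewrite subr0 !lt_min => /andP[/andP[v1 v2] /andP[v3 v4]].
set x := Re v; set y := Im v; set V := nc v in v1 v2 v3 v4 *.
have xV : `|x| <= V := Re_le_nc v.
have yV : `|y| <= V := Im_le_nc v.
have V0 : 0 <= V := nc_ge0 v.
have := H1 x (le_lt_trans xV v1); rewrite addr0 mul1r => {H1}H1.
have := H2 y (le_lt_trans yV v2); rewrite addr0 oppr0 mul0r subr0 => {H2}H2.
have := H3 y (le_lt_trans yV v3); rewrite addr0 mul1r subr0 => {H3}H3.
have cexp0 : cexp 0 = 1.
  by rewrite /cexp polar_pt /= expR0 cos0 sin0 mulr0 mulr1.
have -> : cexp v - cexp 0 - 1 * v =
   pt (expR x * cos y - 1 - x) (expR x * sin y - y).
  rewrite cexp0 /cexp polar_pt.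
  by apply: complexP; rewrite ?ReD ?ImD ?ReN ?ImN ?ReM ?ImM /= -/x -/y; ring.
apply: le_trans (nc_pt _ _) _.
have EX : `|expR x - 1 - x| <= e' * V by apply: le_trans H1 _; rewrite ler_pM2l.
have CY : `|cos y - 1| <= e' * V by apply: le_trans H2 _; rewrite ler_pM2l.
have SY : `|sin y - y| <= e' * V by apply: le_trans H3 _; rewrite ler_pM2l.
have C1 := cos_max y; have S1 := sin_max y.
move: EX CY SY C1 S1 xV yV; rewrite !ler_norml.
move=> /andP[a1 a2] /andP[b1 b2] /andP[c1 c2] /andP[g1 g2] /andP[h1 h2]
  /andP[x1 x2] /andP[y1 y2].
have -> : expR x * cos y - 1 - x =
    (expR x - 1 - x) * cos y + (1 + x) * (cos y - 1) by ring.
have -> : expR x * sin y - y = (expR x - 1) * sin y + (sin y - y) by ring.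
have V1 : V <= 1 by lra.
apply: (@le_trans _ _ ((e' * V + 2 * (e' * V)) + (4 * (e' * V) + e' * V))).
  apply: lerD.
    apply: le_trans (ler_normD _ _) _; apply: lerD.
      rewrite normrM -[e' * V]mulr1 ler_pM // ?cos_max // ler_norml; lra.
    rewrite normrM ler_pM //; first by rewrite ler_norml; lra.
    by rewrite ler_norml b1 b2.
  apply: le_trans (ler_normD _ _) _; apply: lerD; last first.
    by rewrite ler_norml c1 c2.
  rewrite normrM; apply: (@le_trans _ _ ((2 * V) * (2 * e'))); last by nra.
  apply: ler_pM => //; first by rewrite ler_norml; apply/andP; split; nra.
  rewrite ler_norml; apply/andP; split; nra.
nra.
Qed.

Lemma has_cderiv_cexp w : has_cderiv cexp w (cexp w).
Proof.
have h1 : has_cderiv (fun v : C => v - w) w (1 - 0).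
  exact: (has_cderivB (has_cderiv_id w) (has_cderiv_cst w w)).
have h2 : has_cderiv cexp (w - w) 1 by rewrite subrr; exact: has_cderiv_cexp0.
have := has_cderivZ (cexp w) (has_cderiv_comp h1 h2).
rewrite subr0 !mulr1; apply: (@has_cderiv_local _ _ _ _ _ 1) => // v _.
by rewrite -cexpD addrC subrK.
Qed.

Lemma continuous_polar (r : R) : continuous (fun t : R => polar r t : C).
Proof.
move=> t; have -> : (fun t : R => polar r t : C) =
    (fun t => pt (r * cos t) (r * sin t)) by apply/funext => u; rewrite polar_pt.
apply: cvg_complex; apply: cvgM; try exact: cvg_cst.
  exact: continuous_cos.
exact: continuous_sin.
Qed.

End PolarCoordinates.

(** * Integrals over circles and the formula of Cauchy *)

Section CircleIntegrals.
Context {R : realType}.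
Local Notation C := (cplx R).
Local Notation nc := (@Normc.normc R).
Local Notation Re := (@complex.Re R).
Local Notation Im := (@complex.Im R).
Local Notation pt := (fun s t : R => (s +i* t)%C : C).
Implicit Types (f g h q : C -> C) (z w l : C) (r s e : R).

Definition circle_int f r : C := cint 0 (2 * pi) (fun t => f (polar r t)).

Lemma two_pi_gt0 : 0 < 2 * pi :> R.
Proof. by rewrite mulr_gt0 // pi_gt0. Qed.

Lemma halve_twice e (x : R) : x != 0 -> 2 * (e / (2 * x)) * x = e.
Proof. by move=> x0; field. Qed.

Lemma two_pi_neq0 : 2 * pi != 0 :> R.
Proof. exact/lt0r_neq0/two_pi_gt0. Qed.

Lemma polar_2pi r : polar r (2 * pi) = polar r 0.
Proof.
rewrite !polar_pt; have -> : 2 * pi = pi *+ 2 :> R by rewrite mulr_natl.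
by rewrite cos2pi sin2pi cos0 sin0.
Qed.

Definition circle_cont f r := forall t, {for polar r t : C, continuous f}.

Lemma circle_cont_on f r a b : circle_cont f r ->
  cont_on a b (fun t => f (polar r t)).
Proof.
move=> cf t _.
exact: (continuous_comp_curve (@continuous_polar R r t) (cf t)).
Qed.

(** In the coordinates [ln r] and [t] an annulus is a rectangle. Its sides [t = 0]
    and [t = 2 pi] carry the same integral by periodicity, so the theorem of
    Goursat equates the integrals over the two other sides, which are the
    bounding circles. *)
Lemma circle_int_const f r1 r2 : 0 < r1 < r2 ->
  (forall z, r1 <= nc z <= r2 -> exists l, has_cderiv f z l) ->
  circle_int f r1 = circle_int f r2.
Proof.
move=> /andP[r10 r12] df; have r20 := lt_trans r10 r12.
have ln12 : ln r1 < ln r2 by rewrite ltr_ln ?posrE.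
pose F w := f (cexp w).
have dF s t : ln r1 <= s <= ln r2 -> 0 <= t <= 2 * pi ->
    exists l, has_cderiv F (pt s t) l.
  move=> /andP[s1 s2] _; have [|l Hl] := df (cexp (pt s t)).
    rewrite /cexp nc_polar ger0_norm ?expR_ge0 //=.
    by rewrite -ler_ln ?posrE ?expR_gt0 // expRK s1 -ler_ln ?posrE ?expR_gt0 // expRK.
  by exists (l * cexp (pt s t)); exact: has_cderiv_comp (has_cderiv_cexp _) Hl.
have := goursat ln12 two_pi_gt0 dF; rewrite /rect_int.
have E r : 0 < r -> cint 0 (2 * pi) (fun t => F (pt (ln r) t)) = circle_int f r.
  move=> r0; apply: eq_cint => t _; rewrite /F /cexp /=.
  by rewrite lnK ?posrE.
rewrite !E //.
have -> : cint (ln r1) (ln r2) (fun s => F (pt s (2 * pi))) =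
          cint (ln r1) (ln r2) (fun s => F (pt s 0)).
  by apply: eq_cint => s _; rewrite /F /cexp /= polar_2pi.
set x := cint _ _ _; set i := (0 +i* 1)%C => H.
have i0 : (i : C) != 0 by rewrite -nc_gt0 nc_ii.
apply: (mulfI i0); apply/eqP; rewrite eq_sym -subr_eq0 -H; apply/eqP; ring.
Qed.

(** The circle is compact, hence continuity at its points is uniform along it. *)
Lemma circle_unif_cont f s e : 0 < e -> circle_cont f s ->
  exists2 d : R, 0 < d & forall r t, `|r - s| < d -> 0 <= t <= 2 * pi ->
    nc (f (polar r t) - f (polar s t)) < e.
Proof.
move=> e0 cf; have e2 : 0 < e / 2 by rewrite divr_gt0.
have /compact_near_coveringP cK := @segment_compact R 0 (2 * pi).
pose P r t := nc (f (polar r t) - f (polar s t)) < e.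
have : \forall r \near s, `[0, 2 * pi] `<=` P r.
  apply: (cK R (nbhs s) P _) => t _.
  have [d d0 Hd] := proj1 (cont_ncP f (polar s t)) (cf t) _ e2.
  have d2 : 0 < d / 2 by rewrite divr_gt0.
  have := proj1 (@cvg_ncP R _ (nbhs t) _ _ _) (@continuous_polar R s t) _ d2.
  move=> Ht; exists ([set t' : R | nc (polar s t' - polar s t) < d / 2],
    ball s (d / 2)).
    split; first exact: (Ht _).
    exact: nbhsx_ballx d2.
  move=> [t' r] [Ht' Hr]; rewrite /P /fst /snd in Ht' Hr *.
  have {}Hr : `|r - s| < d / 2 by rewrite distrC.
  have {}Ht' : nc (polar s t' - polar s t) < d / 2 := Ht'.
  have t'1 : nc (polar s t' - polar s t) < d by lra.
  have t'2 : nc (polar r t' - polar s t) < d.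
    have := ncD (polar r t' - polar s t') (polar s t' - polar s t).
    rewrite addrA subrK nc_polarB; lra.
  have := ncB (f (polar r t') - f (polar s t)) (f (polar s t') - f (polar s t)).
  rewrite [X in nc X <= _](_ : _ = f (polar r t') - f (polar s t')); last by ring.
  have := Hd _ t'1; have := Hd _ t'2; lra.
move=> /nbhs_ballP[d /= d0 Hd]; exists d => // r t rs t02.
have rb : ball_ (fun x : R => `|x|) s d r by rewrite /ball_ /= distrC.
by apply: (Hd r rb t); rewrite /= in_itv.
Qed.

Lemma circle_int_cont f s e : 0 < e -> circle_cont f s ->
  exists2 d : R, 0 < d & forall r, `|r - s| < d -> circle_cont f r ->
    nc (circle_int f r - circle_int f s) <= e.
Proof.
move=> e0 cf; have p0 := two_pi_gt0.
have e'0 : 0 < e / (2 * (2 * pi)) by rewrite divr_gt0 // mulr_gt0.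
have [d d0 Hd] := circle_unif_cont e'0 cf; exists d => // r rs cr.
have c1 : cont_on 0 (2 * pi) _ := circle_cont_on cf.
have c2 : cont_on 0 (2 * pi) _ := circle_cont_on cr.
rewrite /circle_int -cintB //.
rewrite -(halve_twice e two_pi_neq0) -[X in _ <= _ * X]subr0.
apply: nc_cint_bound; first exact: ltW.
  by move=> t tt; exact: (cvgB (c2 t tt) (c1 t tt)).
by move=> t t02; apply/ltW/Hd.
Qed.

Lemma circle_int_bound f r e : circle_cont f r ->
  (forall z, nc z = `|r| -> nc (f z) <= e) ->
  nc (circle_int f r) <= 2 * e * (2 * pi).
Proof.
move=> cf H; rewrite -[X in _ <= _ * X]subr0; apply: nc_cint_bound.
- exact/ltW/two_pi_gt0.
- exact: circle_cont_on.
by move=> t _; apply: H; rewrite nc_polar.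
Qed.

Lemma circle_cont_cderiv f r :
  (forall z, nc z = `|r| -> exists l, has_cderiv f z l) -> circle_cont f r.
Proof.
move=> df t; have [|l] := df (polar r t); first exact: nc_polar.
exact: has_cderiv_continuous.
Qed.

Definition holo_on (rho : R) f :=
  forall z, nc z < rho -> exists l, has_cderiv f z l.

(** The integral of [1 / (z - z0)] with respect to [dt] does not depend on the
    radius beyond [|z0|], and it tends to 0 at infinity. *)
Lemma circle_int_pole (z0 : C) r : nc z0 < r ->
  circle_int (fun z => (z - z0)^-1) r = 0.
Proof.
move=> z0r; have r0 : 0 < r := le_lt_trans (nc_ge0 z0) z0r.
have dk z : nc z0 < nc z -> exists l, has_cderiv (fun z => (z - z0)^-1) z l.
  move=> zz; exists (- (1 - 0) / (z - z0) ^+ 2); apply: has_cderivV.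
    by apply/eqP => /subr0_eq E; rewrite E ltxx in zz.
  exact: (has_cderivB (has_cderiv_id z) (has_cderiv_cst z0 z)).
apply/eqP; rewrite -nc_eq0 eq_le nc_ge0 andbT; apply/ler_addgt0Pr => e e0.
have p0 := two_pi_gt0; have pp : 0 < 2 * (2 * pi) / e :> R.
  by rewrite divr_gt0 // mulr_gt0.
pose r' := r + nc z0 + 2 * (2 * pi) / e.
have rr' : r < r' by rewrite /r'; have := nc_ge0 z0; lra.
rewrite (@circle_int_const _ r r') ?r0 //; last first.
  by move=> z /andP[/(lt_le_trans z0r) /dk].
rewrite add0r; have r'0 := lt_trans r0 rr'.
rewrite -(halve_twice e two_pi_neq0).
apply: circle_int_bound.
  apply: circle_cont_cderiv => z; rewrite gtr0_norm // => zr'; apply: dk.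
  by rewrite zr' (lt_trans z0r).
move=> z; rewrite gtr0_norm // => zr'; rewrite ncV.
have := ler_ncB z z0; rewrite zr' => H.
have H' : 2 * (2 * pi) / e <= nc (z - z0) by move: H; rewrite /r'; lra.
by rewrite -[e / _]invf_div lef_pV2 ?posrE // (lt_le_trans pp).
Qed.

(** The function [q z = z (h z - h z0) / (z - z0)], completed by [z0 * h' z0] at
    [z0], is continuous on the disc and derivable away from [z0]. Its integral
    over circles is constant for radii below [|z0|] and for radii above [|z0|],
    continuous at [|z0|], and tends to 0 with the radius: it vanishes. This
    replaces the removal of the singularity at [z0]. *)
Lemma cauchy_formula h (z0 : C) r : nc z0 < r < 1 -> holo_on 1 h ->
  rc (2 * pi) * h z0 = circle_int (fun z => h z * z * (z - z0)^-1) r.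
Proof.
move=> /andP[z0r r1] hh; have r0 : 0 < r := le_lt_trans (nc_ge0 z0) z0r.
have z01 := lt_trans z0r r1.
have [l0 /has_cderiv_slope[psi [cpsi _ Epsi]]] := hh z0 z01.
pose q z := z * psi z.
have dpsi z : nc z < 1 -> z != z0 -> exists l, has_cderiv psi z l.
  move=> z1 zz0; have [l Hl] := hh z z1.
  have zz00 : z - z0 != 0 by rewrite subr_eq0.
  have hB c : has_cderiv (fun w : C => w - c) z (1 - 0).
    exact: (has_cderivB (has_cderiv_id z) (has_cderiv_cst c z)).
  have hV := @has_cderivV _ (fun w : C => w - z0) z _ zz00 (hB z0).
  have hN := has_cderivB Hl (has_cderiv_cst (h z0) z).
  exists ((h z - h z0) * (- (1 - 0) / (z - z0) ^+ 2) + (l - 0) * (z - z0)^-1).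
  have dz : 0 < nc (z - z0) by rewrite nc_gt0.
  apply: has_cderiv_local (has_cderivM hN hV); first exact: dz.
  move=> w; rewrite Epsi => wz; rewrite mulfK //.
  apply/eqP => /subr0_eq wE; move: wz; rewrite wE nc_distC ltxx //.
have dq z : nc z < 1 -> z != z0 -> exists l, has_cderiv q z l.
  move=> z1 zz0; have [l Hl] := dpsi z z1 zz0.
  by exists (z * l + 1 * psi z); exact: has_cderivM (has_cderiv_id z) Hl.
have cq z : nc z < 1 -> {for z, continuous q}.
  move=> z1; have [->|zz0] := eqVneq z z0; last first.
    by have [l /has_cderiv_continuous] := dq z z1 zz0.
  have cid : {for z0, continuous (fun w : C => w)} := cvg_id.
  exact: (cvgM cid cpsi).
have ccq s : 0 < s < 1 -> circle_cont q s.
  by move=> /andP[s0 s1] t; apply: cq; rewrite nc_polar gtr0_norm.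
have p0 := two_pi_gt0.
(* the integrals of q over small circles are small *)
have qsmall e s : 0 < e -> 0 < s -> exists2 s', 0 < s' < Num.min s r &
    nc (circle_int q s') <= e.
  move=> e0 s0; have e'0 : 0 < e / (2 * (2 * pi)) by rewrite divr_gt0 // mulr_gt0.
  have c0 : nc (0 : C) < 1 by rewrite nc0.
  have [d d0 Hd] := proj1 (cont_ncP q 0) (cq 0 c0) _ e'0.
  pose s' := Num.min (Num.min s r) d / 2.
  have m0 : 0 < Num.min (Num.min s r) d by rewrite !lt_min s0 r0 d0.
  have s'0 : 0 < s' by rewrite divr_gt0.
  have : s' < Num.min (Num.min s r) d by rewrite /s'; lra.
  rewrite lt_min => /andP[s'sr s'd]; exists s'; first by rewrite s'0.
  have s'1 : s' < 1 by move: s'sr; rewrite lt_min => /andP[_ /lt_trans]; apply.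
  rewrite -(halve_twice e two_pi_neq0).
  apply: circle_int_bound; first by apply: ccq; rewrite s'0.
  move=> z; rewrite gtr0_norm // => zs'.
  have := Hd z; rewrite subr0 zs' => /(_ s'd) /ltW.
  by rewrite /q mul0r subr0.
have Jq : circle_int q r = 0.
  apply/eqP; rewrite -nc_eq0 eq_le nc_ge0 andbT; apply/ler_addgt0Pr => e e0.
  rewrite add0r; have [z00|z00] := eqVneq z0 0.
    have [s' /andP[s'0 s'r] Hs'] := qsmall e r e0 r0.
    rewrite minxx in s'r; rewrite -(@circle_int_const q s' r) ?s'0 //.
    move=> z /andP[z1 z2]; apply: dq; first exact: le_lt_trans r1.
    by rewrite z00 -nc_gt0 (lt_le_trans s'0).
  have e3 : 0 < e / 3 by rewrite divr_gt0.
  pose s := nc z0; have s0 : 0 < s by rewrite nc_gt0.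
  have s01 : 0 < s < 1 by rewrite s0.
  have [d d0 Hd] := circle_int_cont e3 (ccq s s01).
  have d2 : 0 < d / 2 by rewrite divr_gt0.
  pose ra := Num.max (s / 2) (s - d / 2).
  have ra0 : 0 < ra by rewrite lt_max divr_gt0.
  have ras : ra < s by rewrite gt_max; apply/andP; split; lra.
  have rad : s - d / 2 <= ra by rewrite le_max lexx orbT.
  pose rb := Num.min r (s + d / 2).
  have srb : s < rb by rewrite lt_min z0r /=; lra.
  have rbr : rb <= r by rewrite ge_min lexx.
  have rbd : rb <= s + d / 2 by rewrite ge_min lexx orbT.
  clearbody ra rb.
  have [s' /andP[s'0 s'r] Hs'] := qsmall (e / 3) ra e3 ra0.
  have {s'r}s'ra : s' < ra by move: s'r; rewrite lt_min => /andP[].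
  have E1 : circle_int q s' = circle_int q ra.
    apply: circle_int_const; first by rewrite s'0.
    move=> z /andP[z1 z2]; apply: dq; first by lra.
    by apply/eqP => zE; move: z2; rewrite zE -/s; lra.
  have E2 : circle_int q rb = circle_int q r.
    have [->//|rbr'] := eqVneq rb r.
    apply: circle_int_const; first by rewrite (lt_trans s0) // lt_neqAle rbr'.
    move=> z /andP[z1 z2]; apply: dq; first by lra.
    by apply/eqP => zE; move: z1; rewrite zE -/s; lra.
  have H1 : nc (circle_int q ra - circle_int q s) <= e / 3.
    apply: Hd; first by rewrite ltr_norml; lra.
    by apply: ccq; rewrite ra0; lra.
  have H2 : nc (circle_int q rb - circle_int q s) <= e / 3.
    apply: Hd; first by rewrite ltr_norml; lra.
    by apply: ccq; rewrite (lt_trans s0) //; lra.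
  rewrite -E2.
  have := ncD (circle_int q rb - circle_int q s) (circle_int q s).
  have := ncD (circle_int q s - circle_int q ra) (circle_int q ra).
  rewrite !subrK nc_distC; rewrite E1 in Hs'; lra.
have nz t : polar r t - z0 != 0.
  apply/eqP => /subr0_eq E.
  by move: z0r; rewrite -E nc_polar gtr0_norm // ltxx.
have crz : cont_on 0 (2 * pi) (fun t => polar r t : C).
  by move=> t _; exact: continuous_polar.
have cc (c : C) : cont_on 0 (2 * pi) (fun _ : R => c) by exact: cont_on_cst.
have cz : cont_on 0 (2 * pi) (fun t => polar r t - z0).
  exact: (cont_onD crz (cc (- z0))).
have cV : cont_on 0 (2 * pi) (fun t => (polar r t - z0)^-1).
  exact: (cont_onV (fun t _ => nz t) cz).
have ch : cont_on 0 (2 * pi) (fun t => h (polar r t)).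
  apply: circle_cont_on; apply: circle_cont_cderiv => z.
  by rewrite gtr0_norm // => zr; apply: hh; rewrite zr.
have chh := cont_onM (cont_onM ch crz) cV.
have cqr : cont_on 0 (2 * pi) (fun t => q (polar r t)).
  by apply: circle_cont_on; apply: ccq; rewrite r0.
pose k (t : R) := h z0 + (h z0 * z0) * (polar r t - z0)^-1.
have ck : cont_on 0 (2 * pi) k.
  exact: (cont_onD (cc _) (cont_onM (cc _) cV)).
have -> : circle_int (fun z => h z * z * (z - z0)^-1) r =
   cint 0 (2 * pi) (fun t => q (polar r t) + k t).
  apply: eq_cint => t _; rewrite /q /k.
  have -> : psi (polar r t) = (h (polar r t) - h z0) / (polar r t - z0).
    by rewrite Epsi mulfK.
  by field; exact: nz.
rewrite (cintD cqr ck) -[cint _ _ _]/(circle_int q r) Jq add0r.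
rewrite /k (cintD (cc _) (cont_onM (cc _) cV)).
rewrite (cintZl _ cV) -[cint _ _ (fun t => _^-1)]/(circle_int (fun z => (z - z0)^-1) r).
by rewrite circle_int_pole // mulr0 addr0 (cint_cst _ (ltW p0)) subr0 mulrC.
Qed.

End CircleIntegrals.

(** * Cauchy kernels and Taylor coefficients *)

Section CauchyKernels.
Context {R : realType}.
Local Notation C := (cplx R).
Local Notation nc := (@Normc.normc R).
Implicit Types (z w u v : C) (phi zeta : R -> C).

(** Second order expansion of [(zeta - z)^-n] in [z], uniform in [zeta]: here
    [u = (zeta - z)^-1], [v = (zeta - z')^-1] and [w = z' - z]. *)
Lemma inv_pow_expansion (M : R) n : 0 <= M ->
  exists2 K : R, 0 <= K & forall u v w : C, nc u <= M -> nc v <= M ->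
    v - u = w * u * v ->
    nc (v ^+ n - u ^+ n - n%:R * w * u ^+ n.+1) <= K * nc w ^+ 2.
Proof.
move=> M0; elim: n => [|n [K K0 IH]].
  exists 0 => // u v w _ _ _.
  by rewrite !expr0 subrr !mul0r subr0 nc0.
exists (M * K + M ^+ n.+3 + n%:R * M ^+ n.+3).
  have Mn m : 0 <= M ^+ m by exact: exprn_ge0.
  apply: addr_ge0; [apply: addr_ge0|]; first exact: mulr_ge0.
    exact: Mn.
  exact: mulr_ge0 (ler0n _ _) (Mn _).
move=> u v w uM vM E.
have -> : v ^+ n.+1 - u ^+ n.+1 - n.+1%:R * w * u ^+ n.+2 =
   v * (v ^+ n - u ^+ n - n%:R * w * u ^+ n.+1)
   + u ^+ n * (w ^+ 2 * u ^+ 2 * v) + n%:R * w * u ^+ n.+1 * (w * u * v).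
  have -> : w ^+ 2 * u ^+ 2 * v = v - u - w * u ^+ 2.
    have -> : v - u - w * u ^+ 2 = w * u * (v - u).
      by rewrite mulrBr -E; ring.
    by rewrite E; ring.
  rewrite -E -natr1 !exprS; ring.
have Mn m : nc u ^+ m <= M ^+ m by rewrite lerXn2r ?nnegrE ?nc_ge0.
rewrite !mulrDl; apply: le_trans (ncD _ _) _; apply: lerD.
  apply: le_trans (ncD _ _) _; apply: lerD.
    rewrite ncM -[M * K * _]mulrA; apply: ler_pM (IH u v w uM vM E) => //; exact: nc_ge0.
  rewrite !ncM !ncX [X in X <= _](_ : _ =
     nc u ^+ n * (nc u ^+ 2 * nc v) * nc w ^+ 2); last by ring.
  rewrite ler_wpM2r ?exprn_ge0 ?nc_ge0 // -[n.+3]addn3 exprD.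
  have u0 := nc_ge0 u; have v0 := nc_ge0 v.
  rewrite ler_pM ?mulr_ge0 ?exprn_ge0 //.
  by rewrite [M ^+ 3]exprSr ler_pM ?exprn_ge0.
rewrite !ncM !ncX nc_nat [X in X <= _](_ : _ =
  n%:R * (nc u ^+ n.+2 * nc v) * nc w ^+ 2); last by rewrite !exprS; ring.
have u0 := nc_ge0 u; have v0 := nc_ge0 v.
rewrite ler_wpM2r ?exprn_ge0 ?nc_ge0 // ler_wpM2l //.
by rewrite [M ^+ n.+3]exprSr ler_pM // ?exprn_ge0.
Qed.

Definition cauchy_kernel (a b : R) phi zeta (k : nat) z : C :=
  cint a b (fun t => phi t * (zeta t - z)^-1 ^+ k.+1).

Section KernelDerivative.
Variables (a b : R) (phi zeta : R -> C).
Hypotheses (cphi : cont_on a b phi) (czeta : cont_on a b zeta).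

Lemma cont_kernel k z : (forall t, a <= t <= b -> zeta t != z) ->
  cont_on a b (fun t => phi t * (zeta t - z)^-1 ^+ k).
Proof.
move=> Hz; apply: (cont_onM cphi); apply: cont_onX; apply: cont_onV.
  by move=> t /Hz; rewrite subr_eq0.
have cz : cont_on a b (fun _ : R => - z) by exact: cont_on_cst.
exact: (cont_onD czeta cz).
Qed.

(** The expansion [inv_pow_expansion] is integrated term by term. *)
Lemma has_cderiv_kernel k z (d0 : R) : 0 < d0 ->
  (forall t, a <= t <= b -> d0 <= nc (zeta t - z)) ->
  has_cderiv (cauchy_kernel a b phi zeta k) z
    (k.+1%:R * cauchy_kernel a b phi zeta k.+1 z).
Proof.
move=> d00 Hz e e0.
have M0 : 0 <= 2 / d0 by rewrite divr_ge0 // ltW.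
have [K K0 HK] := inv_pow_expansion k.+1 M0.
pose I := rint a b (fun t => nc (phi t)).
have I0 : 0 <= I by apply: rint_ge0 => t _; exact: nc_ge0.
have KI0 : 0 <= 2 * K * I by rewrite !mulr_ge0.
exists (Num.min (d0 / 2) (e / (2 * K * I + 1))).
  by rewrite lt_min !divr_gt0 //; lra.
move=> z'; rewrite lt_min => /andP[z'd z'e]; set w := z' - z.
have nz t : a <= t <= b -> zeta t != z.
  by move=> /Hz H; rewrite -subr_eq0 -nc_gt0 (lt_le_trans d00).
have Hz' t : a <= t <= b -> d0 / 2 <= nc (zeta t - z').
  move=> /Hz H; have := ncD (zeta t - z') (z' - z).
  by rewrite addrA subrK -/w; lra.
have nz' t : a <= t <= b -> zeta t != z'.
  by move=> /Hz' H; rewrite -subr_eq0 -nc_gt0 (lt_le_trans _ H) // divr_gt0.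
pose U t := (zeta t - z)^-1; pose V t := (zeta t - z')^-1.
have c1 := cont_kernel (k := k.+1) nz'.
have c2 := cont_kernel (k := k.+1) nz.
have c3 := cont_kernel (k := k.+2) nz.
have cc (c : C) : cont_on a b (fun _ : R => c) by exact: cont_on_cst.
have cw := cont_onM (cc (k.+1%:R * w)) c3.
have c12 : cont_on a b (fun t => phi t * V t ^+ k.+1 - phi t * U t ^+ k.+1).
  by move=> t tab; exact: (cvgB (c1 t tab) (c2 t tab)).
have c123 : cont_on a b (fun t => phi t * V t ^+ k.+1 - phi t * U t ^+ k.+1
    - k.+1%:R * w * (phi t * U t ^+ k.+2)).
  by move=> t tab; exact: (cvgB (c12 t tab) (cw t tab)).
have -> : cauchy_kernel a b phi zeta k z' - cauchy_kernel a b phi zeta k z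
    - k.+1%:R * cauchy_kernel a b phi zeta k.+1 z * w =
  cint a b (fun t => phi t * V t ^+ k.+1 - phi t * U t ^+ k.+1
    - k.+1%:R * w * (phi t * U t ^+ k.+2)).
  by rewrite (cintB c12 cw) (cintB c1 c2) (cintZl _ c3) [_ * w]mulrAC.
apply: le_trans (nc_cint_le c123) _.
have cn : cont_on a b (fun t => K * nc w ^+ 2 * nc (phi t)).
  move=> t tab; apply: cvgM; first exact: cvg_cst.
  exact: (cont_on_nc cphi tab).
have : rint a b (fun t => nc (phi t * V t ^+ k.+1 - phi t * U t ^+ k.+1
    - k.+1%:R * w * (phi t * U t ^+ k.+2))) <= K * nc w ^+ 2 * I.
  rewrite /I -rintZl; last exact: cont_on_nc.
  apply: ler_rint => //; first exact: cont_on_nc.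
  move=> t tab; have zt := nz t tab; have zt' := nz' t tab.
  have -> : phi t * V t ^+ k.+1 - phi t * U t ^+ k.+1
      - k.+1%:R * w * (phi t * U t ^+ k.+2) =
    phi t * (V t ^+ k.+1 - U t ^+ k.+1 - k.+1%:R * w * U t ^+ k.+2) by ring.
  rewrite ncM mulrC ler_wpM2r ?nc_ge0 //; apply: HK.
  - rewrite /U ncV -[2 / d0]invf_div lef_pV2 ?posrE ?divr_gt0 //.
      by have := Hz t tab; lra.
    by rewrite (lt_le_trans d00) // Hz.
  - rewrite /V ncV -[2 / d0]invf_div lef_pV2 ?posrE ?divr_gt0 //.
      exact: Hz'.
    by rewrite nc_gt0 subr_eq0.
  - by rewrite /U /V /w; field; rewrite !subr_eq0 zt zt'.
have w0 := nc_ge0 w.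
have : nc w * (2 * K * I + 1) <= e.
  by rewrite -ler_pdivlMr; [exact: ltW|lra].
set W := nc w in w0 *; move=> h1 h2; nra.
Qed.

End KernelDerivative.

End CauchyKernels.

Section CauchyEstimates.
Context {R : realType}.
Local Notation C := (cplx R).
Local Notation nc := (@Normc.normc R).
Implicit Types (z w : C) (h f g : C -> C).

Lemma holo_circle_cont h (r : R) : holo_on 1 h -> 0 < r < 1 -> circle_cont h r.
Proof.
move=> hh /andP[r0 r1]; apply: circle_cont_cderiv => z.
by rewrite gtr0_norm // => zr; apply: hh; rewrite zr.
Qed.

Lemma cont_on_polar (r a b : R) : cont_on a b (fun t => polar r t : C).
Proof. by move=> t _; exact: continuous_polar. Qed.

Definition circle_kernel h (r : R) k z : C :=
  cauchy_kernel 0 (2 * pi) (fun t => h (polar r t) * polar r t)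
    (fun t => polar r t) k z.

Lemma cont_circle_kernel h (r : R) : holo_on 1 h -> 0 < r < 1 ->
  cont_on 0 (2 * pi) (fun t => h (polar r t) * polar r t).
Proof.
move=> hh r01; apply: cont_onM; last exact: cont_on_polar.
exact: circle_cont_on (holo_circle_cont hh r01).
Qed.

(** Differentiating the integral formula of Cauchy under the integral sign. *)
Lemma derive1n_cauchy h (r : R) k z : holo_on 1 h -> 0 < r < 1 -> nc z < r ->
  derive1n k h z = (rc (2 * pi))^-1 * (k`!%:R * circle_kernel h r k z).
Proof.
move=> hh r01; have /andP[r0 r1] := r01.
elim: k z => [|k IH] z zr.
  have zr1 : nc z < r < 1 by rewrite zr.
  have p0 : rc (2 * pi) != 0 :> C.
    by rewrite -nc_gt0 nc_rc normr_gt0 two_pi_neq0.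
  rewrite /derive1n /= fact0 mul1r; apply: (mulfI p0).
  by rewrite mulVKf // (cauchy_formula zr1 hh).
rewrite derive1nS; apply: has_cderiv_derive1.
have rz0 : 0 < r - nc z by rewrite subr_gt0.
apply: (@has_cderiv_local _
  (fun w => (rc (2 * pi))^-1 * (k`!%:R * circle_kernel h r k w)) _ _ _ _ rz0).
  move=> w wz; rewrite IH //; have := ler_ncB w z; lra.
have -> : (k.+1)`!%:R * circle_kernel h r k.+1 z =
    k`!%:R * (k.+1%:R * circle_kernel h r k.+1 z).
  by rewrite factS natrM mulrA [_ * k.+1%:R]mulrC.
apply: has_cderivZ; apply: has_cderivZ.
apply: (has_cderiv_kernel _ _ _ rz0).
- exact: cont_circle_kernel.
- exact: cont_on_polar.
- move=> t _; have := ler_ncB (polar r t) z.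
  by rewrite nc_polar gtr0_norm.
Qed.

Lemma taylor_coef_cauchy h (r : R) k : holo_on 1 h -> 0 < r < 1 ->
  taylor_coef h k = (rc (2 * pi))^-1 * circle_kernel h r k 0.
Proof.
move=> hh r01; rewrite /taylor_coef (@derive1n_cauchy h r) ?nc0 //; last first.
  by case/andP: r01.
have k0 : (k`!%:R : C) != 0 by rewrite -nc_gt0 nc_nat ltr0n fact_gt0.
by rewrite [k`!%:R * _]mulrC mulrA mulfK.
Qed.

Lemma nc_taylor_coef_le (r : R) k : 0 < r < 1 ->
  exists2 K : R, 0 < K & forall h (m : R), holo_on 1 h ->
    (forall z, nc z <= r -> nc (h z) <= m) -> nc (taylor_coef h k) <= K * m.
Proof.
move=> r01; have /andP[r0 r1] := r01.
exists ((2 * pi)^-1 * (2 * (r * r^-1 ^+ k.+1) * (2 * pi))).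
  by rewrite !mulr_gt0 ?invr_gt0 ?two_pi_gt0 ?exprn_gt0 ?invr_gt0 ?pi_gt0.
move=> h m hh hm; rewrite (taylor_coef_cauchy k hh r01) ncM ncV nc_rc.
rewrite gtr0_norm ?two_pi_gt0 // -[X in _ <= X]mulrA.
rewrite ler_wpM2l ?invr_ge0 ?(ltW two_pi_gt0) //.
have -> : 2 * (r * r^-1 ^+ k.+1) * (2 * pi) * m =
    2 * (m * r * r^-1 ^+ k.+1) * (2 * pi - 0) by rewrite subr0; ring.
have nz t : 0 <= t <= 2 * pi -> polar r t != 0.
  by move=> _; rewrite -nc_gt0 nc_polar normr_gt0 gt_eqF.
apply: nc_cint_bound; first exact: ltW two_pi_gt0.
  apply: cont_kernel nz; first exact: cont_circle_kernel.
  exact: cont_on_polar.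
move=> t _; rewrite subr0 ncM [nc (h _ * _)]ncM ncX ncV nc_polar gtr0_norm //.
have rk : 0 <= r^-1 ^+ k.+1 by rewrite exprn_ge0 // invr_ge0 ltW.
apply: (ler_wpM2r rk); apply: (ler_wpM2r (ltW r0)).
by apply: hm; rewrite nc_polar gtr0_norm.
Qed.

Lemma holo_onD (r : R) f g : holo_on r f -> holo_on r g ->
  holo_on r (fun z => f z + g z).
Proof.
move=> hf hg z zr; have [l Hl] := hf z zr; have [m Hm] := hg z zr.
by exists (l + m); exact: has_cderivD.
Qed.

Lemma holo_onZ (r : R) c f : holo_on r f -> holo_on r (fun z => c * f z).
Proof.
move=> hf z zr; have [l Hl] := hf z zr.
by exists (c * l); exact: has_cderivZ.
Qed.

Lemma taylor_coefDZ f g (c : C) k : holo_on 1 f -> holo_on 1 g ->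
  taylor_coef (fun z => f z + c * g z) k = taylor_coef f k + c * taylor_coef g k.
Proof.
move=> hf hg; have r01 : 0 < (2^-1 : R) < 1 by lra.
have hcg := holo_onZ c hg.
rewrite !(@taylor_coef_cauchy _ 2^-1) //; last exact: holo_onD.
rewrite mulrCA -mulrDr; congr (_ * _).
have r0 : 0 < 2^-1 :> R by case/andP: r01.
have nz t : 0 <= t <= 2 * pi -> polar 2^-1 t != 0 :> C.
  by move=> _; rewrite -nc_gt0 nc_polar normr_gt0 gt_eqF.
have cp : cont_on 0 (2 * pi) (fun t => polar 2^-1 t : C) by exact: cont_on_polar.
have c1 := cont_kernel (k := k.+1) (cont_circle_kernel hf r01) cp nz.
have c2 := cont_kernel (k := k.+1) (cont_circle_kernel hg r01) cp nz.
have cc : cont_on 0 (2 * pi) (fun _ : R => c) by exact: cont_on_cst.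
rewrite /circle_kernel /cauchy_kernel -(cintZl _ c2) -(cintD c1 (cont_onM cc c2)).
by apply: eq_cint => t _; ring.
Qed.

(** The factor [2 r / (2 pi)] left by the formula of Cauchy is at most 1. *)
Lemma nc_le_circle_mean h (r : R) z : nc z < r < 1 -> holo_on 1 h ->
  nc (h z) <= (r - nc z)^-1 * rint 0 (2 * pi) (fun t => nc (h (polar r t))).
Proof.
move=> zr1 hh; have /andP[zr r1] := zr1.
have r0 : 0 < r := le_lt_trans (nc_ge0 z) zr.
have r01 : 0 < r < 1 by rewrite r0.
have p2 : 2 <= pi :> R by exact: pi_ge2.
have rz0 : 0 < r - nc z by rewrite subr_gt0.
have Hz t : r - nc z <= nc (polar r t - z).
  by have := ler_ncB (polar r t) z; rewrite nc_polar gtr0_norm.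
have nz t : 0 <= t <= 2 * pi -> polar r t != z.
  by move=> _; rewrite -subr_eq0 -nc_gt0 (lt_le_trans rz0).
have cK := cont_kernel (k := 1) (cont_circle_kernel hh r01) (@cont_on_polar r _ _) nz.
have cN : cont_on 0 (2 * pi) (fun t => nc (h (polar r t))).
  exact/cont_on_nc/circle_cont_on/(holo_circle_cont hh r01).
have := cauchy_formula zr1 hh; move/(congr1 nc); rewrite ncM nc_rc.
rewrite gtr0_norm ?two_pi_gt0 // => E.
have := nc_cint_le cK.
have -> : cint 0 (2 * pi) (fun t => h (polar r t) * polar r t * (polar r t - z)^-1 ^+ 1)
  = circle_int (fun z' => h z' * z' * (z' - z)^-1) r by [].
rewrite -E => H.
have : rint 0 (2 * pi) (fun t => nc (h (polar r t) * polar r t * (polar r t - z)^-1 ^+ 1))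
   <= (r - nc z)^-1 * rint 0 (2 * pi) (fun t => nc (h (polar r t))).
  rewrite -rintZl //; apply: ler_rint.
  - exact: cont_on_nc.
  - by move=> t tt; apply: cvgM; [exact: cvg_cst|exact: cN].
  move=> t _; rewrite expr1 ncM [nc (h _ * _)]ncM ncV nc_polar gtr0_norm // mulrC.
  apply: ler_pM; rewrite ?invr_ge0 ?mulr_ge0 ?nc_ge0 ?(ltW r0) //.
    rewrite lef_pV2 ?posrE //; exact: lt_le_trans rz0 (Hz t).
  by rewrite ler_piMr ?nc_ge0 // ltW.
set J := _ * rint _ _ _; have := nc_ge0 (h z); nra.
Qed.

End CauchyEstimates.

(** * From small means to small values *)

Section PowerFunctions.
Context {R : realType}.
Implicit Types (a b p : R).

(** Since [x <= x^p] on [[0, 1]], the ratios of [a] and [b] to [a + b] have powers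
    whose sum is at least 1. *)
Lemma powR_subadditive a b p : 0 <= a -> 0 <= b -> 0 < p < 1 ->
  (a + b) `^ p <= a `^ p + b `^ p.
Proof.
move=> a0 b0 /andP[p0 p1]; have [->|a_n0] := eqVneq a 0.
  by rewrite add0r lerDr powR_ge0.
have ap : 0 < a by rewrite lt_neqAle eq_sym a_n0.
have s0 : 0 < a + b by lra.
have sp0 : 0 < (a + b) `^ p by exact: powR_gt0.
have H x : 0 <= x -> x <= a + b -> x / (a + b) * (a + b) `^ p <= x `^ p.
  move=> x0 xs; have [->|x_n0] := eqVneq x 0.
    by rewrite mul0r mul0r powR_ge0.
  have xp : 0 < x by rewrite lt_neqAle eq_sym x_n0.
  have q0 : 0 < x / (a + b) by rewrite divr_gt0.
  have -> : x `^ p = (x / (a + b)) `^ p * (a + b) `^ p.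
    by rewrite -powRM ?(ltW q0) ?(ltW s0) // divfK // gt_eqF.
  rewrite ler_wpM2r ?(ltW sp0) //; apply: ger1_powR; last exact: ltW.
  by rewrite q0 ler_pdivrMr // mul1r.
have Ha : a <= a + b by lra.
have Hb : b <= a + b by lra.
have := lerD (H a a0 Ha) (H b b0 Hb).
by rewrite -!mulrDl divff ?mul1r // gt_eqF.
Qed.

Lemma powR_dist a b p : 0 <= a -> 0 <= b -> 0 < p < 1 ->
  `|a `^ p - b `^ p| <= `|a - b| `^ p.
Proof.
move=> a0 b0 p01; have H x y : 0 <= x -> 0 <= y -> x `^ p - y `^ p <= `|x - y| `^ p.
  move=> x0 y0; have [/andP[p0 _] xy] := (p01, normr_ge0 (x - y)).
  have := powR_subadditive xy y0 p01.
  have : x `^ p <= (`|x - y| + y) `^ p.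
    apply: ge0_ler_powR; rewrite ?nnegrE ?addr_ge0 //; first exact: ltW.
    by have := ler_norm (x - y); lra.
  lra.
rewrite ler_norml; apply/andP; split; last exact: H.
by have := H b a b0 a0; rewrite distrC; lra.
Qed.

Lemma powRK a p : 0 <= a -> p != 0 -> (a `^ p) `^ p^-1 = a.
Proof. by move=> a0 p0; rewrite -powRrM divff // powRr1. Qed.

Lemma powRVK a p : 0 <= a -> p != 0 -> (a `^ p^-1) `^ p = a.
Proof. by move=> a0 p0; rewrite -powRrM mulVf // powRr1. Qed.

Lemma powR_small p (e : R) : 0 < p -> 0 < e ->
  exists2 d : R, 0 < d & forall x, 0 <= x < d -> x `^ p < e.
Proof.
move=> p0 e0; exists (e `^ p^-1); first exact: powR_gt0.
move=> x /andP[x0 xe]; rewrite -[e](@powRVK _ p) ?(ltW e0) ?gt_eqF //.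
by apply: gt0_ltr_powR; rewrite ?nnegrE ?powR_ge0.
Qed.

(** [powR] jumps at 0 from the left, where its value is 1, hence the sign
    condition on [f]. *)
Lemma cont_on_powR (c d p : R) (f : R -> R) : 0 < p < 1 ->
  (forall t, 0 <= f t) -> cont_on c d f -> cont_on c d (fun t => f t `^ p).
Proof.
move=> p01 f0 cf t /cf /cvgrPdist_lt ct; apply/cvgrPdist_lt => e e0.
have /andP[p0 _] := p01; have [d' d'0 Hd] := powR_small p0 e0.
apply: filterS (ct _ d'0) => u ftu.
apply: le_lt_trans (powR_dist (f0 _) (f0 _) p01) _.
by apply: Hd; rewrite normr_ge0.
Qed.

End PowerFunctions.

Section HardyLittlewood.
Context {R : realType}.
Local Notation C := (cplx R).
Local Notation nc := (@Normc.normc R).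
Implicit Types (h : C -> C) (r p : R).

Lemma cont_on_circle_powR h r p a b : holo_on 1 h -> 0 < r < 1 -> 0 < p < 1 ->
  cont_on a b (fun t => nc (h (polar r t)) `^ p).
Proof.
move=> hh r01 p01; apply: cont_on_powR => // [t|]; first exact: nc_ge0.
exact/cont_on_nc/circle_cont_on/(holo_circle_cont hh r01).
Qed.

(** The mean of [|h|] over a larger circle bounds [|h|] on the disc, by the formula
    of Cauchy. *)
Lemma holo_bounded h r : holo_on 1 h -> 0 <= r < 1 ->
  exists2 M : R, 0 <= M & forall z, nc z <= r -> nc (h z) <= M.
Proof.
move=> hh /andP[r0 r1]; pose s := (1 + r) / 2.
have rs : r < s by rewrite /s; lra.
have s1 : s < 1 by rewrite /s; lra.
pose I := rint 0 (2 * pi) (fun t => nc (h (polar s t))).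
have I0 : 0 <= I by apply: rint_ge0 => t _; exact: nc_ge0.
have sr0 : 0 < s - r by lra.
exists ((s - r)^-1 * I); first by rewrite mulr_ge0 ?invr_ge0 ?(ltW sr0).
move=> z zr; have zs : nc z < s < 1 by rewrite s1 (le_lt_trans zr).
apply: le_trans (nc_le_circle_mean zs hh) _; rewrite -/I.
by rewrite ler_wpM2r // lef_pV2 ?posrE //; lra.
Qed.

(** For [p < 1] the [p]-means do not bound the values through an integral
    formula. The trick of Hardy and Littlewood: if [N] is the supremum of
    [(1/2 - |z|)^(1/p) |h z|], write [|h| = |h|^(1-p) |h|^p] on a circle and
    bound the first factor with [N]; the Cauchy formula then gives
    [N <= 2^(1/p) N^(1-p) I], in which [N^(1-p)] cancels. *)
Lemma hardy_littlewood h p (I : R) : holo_on 1 h -> 0 < p < 1 ->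
  (forall r, 0 < r < 1 ->
     rint 0 (2 * pi) (fun t => nc (h (polar r t)) `^ p) <= I) ->
  forall z, nc z <= 4^-1 ->
    nc (h z) <= 4 `^ p^-1 * (2 `^ p^-1 * I) `^ p^-1.
Proof.
move=> hh p01 HI; have /andP[p0 p1] := p01; set al := p^-1.
have p_n0 : p != 0 by rewrite gt_eqF.
have al0 : 0 < al by rewrite invr_gt0.
have alp : al * (1 - p) = al - 1 by rewrite /al; field.
pose W (z : C) := (2^-1 - nc z) `^ al * nc (h z).
pose S := [set W z | z in [set z : C | nc z < 2^-1]].
have W0 z : 0 <= W z by rewrite mulr_ge0 ?powR_ge0 ?nc_ge0.
have h01 : 0 <= (2^-1 : R) < 1 by lra.
have [M M0 HM] := holo_bounded hh h01.
have z00 : nc (0 : C) < 2^-1 by rewrite nc0; lra.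
have ubS : has_ubound S.
  exists M => _ [z zlt <-]; have zM := HM z (ltW zlt).
  have z0 := nc_ge0 z; rewrite -[M]mul1r ler_pM ?powR_ge0 ?nc_ge0 //.
  have zlt' : nc z < 2^-1 := zlt.
  have z1 : 0 < 2^-1 - nc z <= 1 by lra.
  have := @ger_powR _ _ z1 _ _ (ltW al0).
  by rewrite powRr0.
have S0 : S !=set0 by exists (W 0); exists 0.
pose N := sup S.
have WN z : nc z < 2^-1 -> W z <= N by move=> z2; apply: ub_le_sup => //; exists z.
have N0 : 0 <= N by apply: le_trans (W0 0) (WN 0 z00).
have I0 : 0 <= I.
  have h12 : 0 < (2^-1 : R) < 1 by lra.
  by apply: le_trans (HI _ h12); apply: rint_ge0 => t _; exact: powR_ge0.
have key z : nc z < 2^-1 -> W z <= 2 `^ al * N `^ (1 - p) * I.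
  move=> z2; have z0 := nc_ge0 z; pose x := 2^-1 - nc z.
  have x0 : 0 < x by rewrite /x; lra.
  have x20 : 0 < x / 2 by rewrite divr_gt0.
  pose r := nc z + x / 2.
  have rE : 2^-1 - r = x / 2 by rewrite /r /x; field.
  have zr : nc z < r < 1 by rewrite /r /x; lra.
  have r01 : 0 < r < 1 by rewrite /r /x; lra.
  have r0 : 0 < r by case/andP: r01.
  pose T := (x / 2) `^ (- al) * N.
  have T0 : 0 <= T by rewrite mulr_ge0 ?powR_ge0.
  have hT t : nc (h (polar r t)) <= T.
    have pr : nc (polar r t) = r by rewrite nc_polar gtr0_norm.
    have := WN (polar r t); rewrite /W pr rE => /(_ _).
    rewrite /T powRN ler_pdivlMl ?powR_gt0 //; apply.
    by rewrite /r /x; lra.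
  have split_pow y : 0 <= y -> y <= T -> y <= T `^ (1 - p) * y `^ p.
    move=> y0 yT; rewrite [X in X <= _](_ : y = y `^ (1 - p) * y `^ p); last first.
      by rewrite -powRD ?subrK ?oner_eq0 // powRr1.
    rewrite ler_wpM2r ?powR_ge0 //; apply: ge0_ler_powR; rewrite ?nnegrE //.
    by rewrite subr_ge0 ltW.
  have cp := cont_on_circle_powR (a := 0) (b := 2 * pi) hh r01 p01.
  have bnd : rint 0 (2 * pi) (fun t => nc (h (polar r t))) <= T `^ (1 - p) * I.
    apply: le_trans (ler_wpM2l (powR_ge0 _ _) (HI r r01)).
    rewrite -rintZl //; apply: ler_rint.
    - exact/cont_on_nc/circle_cont_on/(holo_circle_cont hh r01).
    - by move=> t tt; apply: cvgM; [exact: cvg_cst|exact: cp].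
    by move=> t _; apply: split_pow => //; exact: nc_ge0.
  have := nc_le_circle_mean zr hh.
  have -> : r - nc z = x / 2 by rewrite /r; ring.
  move=> H1; have {bnd}H2 := ler_wpM2l (ltW (lt_le_trans (_ : 0 < (x / 2)^-1) (lexx _))) bnd.
  have {H1 H2} : nc (h z) <= (x / 2)^-1 * (T `^ (1 - p) * I).
    by apply: le_trans H1 (H2 _); rewrite invr_gt0.
  rewrite /W -/x => H; apply: le_trans (ler_wpM2l (powR_ge0 _ _) H) _.
  have x2p : 0 < (x / 2) `^ al by exact: powR_gt0.
  have -> : T `^ (1 - p) = (x / 2) `^ (- (al - 1)) * N `^ (1 - p).
    by rewrite /T powRM ?powR_ge0 // -powRrM mulNr alp.
  have -> : (x / 2) `^ (- (al - 1)) = (x / 2) * (x / 2) `^ (- al).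
    rewrite opprB powRD; last by apply/implyP => _; rewrite gt_eqF.
    by rewrite powRr1 // ltW.
  have -> : x `^ al = 2 `^ al * (x / 2) `^ al.
    by rewrite -powRM ?(ltW x20) // mulrC divfK.
  rewrite powRN le_eqVlt; apply/orP; left; apply/eqP.
  by field; rewrite !gt_eqF.
have Nle : N <= 2 `^ al * N `^ (1 - p) * I.
  by apply: ge_sup => // _ [z z2 <-]; exact: key.
have NI : N <= (2 `^ al * I) `^ al.
  have [->|N_n0] := eqVneq N 0; first exact: powR_ge0.
  have Np : 0 < N by rewrite lt_neqAle eq_sym N_n0.
  rewrite -(powRK N0 p_n0); apply: ge0_ler_powR; rewrite ?nnegrE ?powR_ge0 //.
  - exact: ltW.
  - by rewrite mulr_ge0 ?powR_ge0.
  have N1p : 0 < N `^ (1 - p) by exact: powR_gt0.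
  rewrite -(ler_pM2l N1p) -powRD ?subrK ?oner_eq0 // powRr1 //.
  by apply: le_trans Nle _; rewrite mulrA [N `^ _ * _]mulrC.
move=> z z4; have z2 : nc z < 2^-1 by lra.
have := le_trans (WN z z2) NI; rewrite /W => H.
have p4 : 0 < 4 `^ al :> R by exact: powR_gt0.
rewrite -ler_pdivrMl // -powR_inv1 ?powR_ge0 // -powRrM mulrN1 powRN.
apply: le_trans H; rewrite ler_wpM2r ?nc_ge0 //.
rewrite -powR_inv1 ?powR_ge0 // -powRrM mulrC powRrM powR_inv1 //.
apply: ge0_ler_powR; rewrite ?nnegrE ?(ltW al0) //; lra.
Qed.

Lemma holo_small_on_quarter p (e : R) : 0 < p < 1 -> 0 < e ->
  exists2 d : R, 0 < d & forall h, holo_on 1 h ->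
    (forall r, 0 < r < 1 ->
       rint 0 (2 * pi) (fun t => nc (h (polar r t)) `^ p) <= d) ->
    forall z, nc z <= 4^-1 -> nc (h z) <= e.
Proof.
move=> p01 e0; have /andP[p0 p1] := p01.
have p4 : 0 < 4 `^ p^-1 :> R by exact: powR_gt0.
have p2 : 0 < 2 `^ p^-1 :> R by exact: powR_gt0.
exists ((e / 4 `^ p^-1) `^ p / 2 `^ p^-1).
  by rewrite divr_gt0 // powR_gt0 // divr_gt0.
move=> h hh Hd z /(hardy_littlewood hh p01 Hd).
rewrite mulrCA divff ?gt_eqF // mulr1 powRK ?gt_eqF //; last first.
  by rewrite divr_ge0 ?(ltW e0) ?(ltW p4).
by rewrite mulrC divfK // gt_eqF.
Qed.

End HardyLittlewood.

(** * Arc integrals of powers of |1 - z| *)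

Section ArcIntegralEstimate.
Context {R : realType}.
Local Notation C := (cplx R).
Local Notation nc := (@Normc.normc R).
Implicit Types (r t a : R).

Lemma nc_onem_polar r t : nc (1 - polar r t) ^+ 2 = 1 - 2 * r * cos t + r ^+ 2.
Proof.
rewrite nc2 polar_pt ReD ImD ReN ImN /= -[r in RHS]mulr1.
have := cos2Dsin2 t; set c := cos t; set s := sin t => E.
have -> : (r * 1) ^+ 2 = r ^+ 2 * (c ^+ 2 + s ^+ 2) by rewrite E; ring.
ring.
Qed.

Lemma nc_onem_polar_gt0 r t : 0 < r < 1 -> 0 < nc (1 - polar r t).
Proof.
move=> /andP[r0 r1]; rewrite nc_gt0; apply/eqP => /subr0_eq E.
by have := nc_polar r t; rewrite -E nc1 gtr0_norm // => rE; rewrite rE ltxx in r1.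
Qed.

Let D r t : R := 1 - 2 * r * cos t + r ^+ 2.

Let sigma r a t : R := sin t * D r t `^ (- (a / 2)).

Let dD r t : is_derive t 1 (D r) (2 * r * sin t).
Proof.
have h := is_deriveD (is_deriveB (is_derive_cst (1 : R) t 1)
  (is_deriveZ (2 * r) (is_derive_cos t))) (is_derive_cst (r ^+ 2) t 1).
by apply: is_derive_eq; rewrite /GRing.scale /=; ring.
Qed.

Let dsigma r a t : 0 < r < 1 -> is_derive t 1 (sigma r a)
  (cos t * D r t `^ (- (a / 2)) -
   a * r * sin t ^+ 2 * D r t `^ (- (a / 2) - 1)).
Proof.
move=> r01; have D0 : 0 < D r t.
  by rewrite /D -nc_onem_polar exprn_gt0 // nc_onem_polar_gt0.
have h1 := is_derive1_comp (is_derive1_powR (- (a / 2)) D0) (dD r t).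
have h2 := is_deriveM (is_derive_sin t) h1.
apply: is_derive_eq; rewrite /GRing.scale /=.
by rewrite [sin t ^+ 2]expr2; field.
Qed.

(** The integrals stay bounded as [r] tends to 1, although their limit is
    improper: up to a bounded error the integrand is at most a constant times
    the derivative of the bounded function
    [t |-> sin t * |1 - r e^(it)| ^ (- a)]. *)
Lemma rint_onem_polar_powR (A B r a : R) : A <= B -> 0 < r < 1 -> 0 < a < 1 ->
  rint A B (fun t => nc (1 - polar r t) `^ (- a)) <= (8 + 8 * (B - A)) / (1 - a).
Proof.
move=> AB r01 /andP[a0 a1]; have /andP[r0 r1] := r01.
pose N t := nc (1 - polar r t).
have N0 t : 0 < N t by exact: nc_onem_polar_gt0.
have DN t : D r t = N t ^+ 2 by rewrite /N nc_onem_polar.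
have D0 t : 0 < D r t by rewrite DN exprn_gt0.
have D4 t : D r t <= 4 by rewrite /D; have := cos_geN1 t; nra.
have DE (b : R) t : N t `^ b = D r t `^ (b / 2).
  rewrite DN -powR_mulrn ?(ltW (N0 t)) // -powRrM.
  by congr (_ `^ _); field.
have cosD t : 1 - cos t <= 2 * D r t.
  rewrite /D; have := cos_geN1 t; have := cos_le1 t; set c := cos t => c1 c2.
  have [c0|c0] := leP 0 c; last by nra.
  have : 0 <= (2 * r - 2 * c) ^+ 2 by rewrite sqr_ge0.
  nra.
have sinD t : sin t ^+ 2 <= D r t.
  rewrite /D; have := cos2Dsin2 t; set c := cos t => E.
  have : 0 <= (r - c) ^+ 2 by rewrite sqr_ge0.
  nra.
have D4p (b : R) t : 0 <= b <= 1 -> D r t `^ b <= 4.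
  move=> /andP[b0 b1]; have [D1|D1] := leP 1 (D r t).
    by apply: le_trans (D4 t); apply: ler1_powR.
  have Dr : 0 < D r t <= 1 by rewrite D0 ltW.
  have := @ger_powR _ _ Dr _ _ b0; rewrite powRr0; lra.
pose S t := D r t `^ (- (a / 2)).
have S0 t : 0 <= S t by exact: powR_ge0.
have DS t : D r t * S t <= 4.
  rewrite -[D r t in X in X <= _]powRr1 ?(ltW (D0 t)) // /S -powRD; last first.
    by apply/implyP => _; rewrite gt_eqF.
  by apply: D4p; lra.
have Sm t : D r t `^ (- (a / 2) - 1) = S t / D r t.
  rewrite powRD; last by apply/implyP => _; rewrite gt_eqF.
  by rewrite powR_inv1 ?(ltW (D0 t)).
pose s' t := cos t * D r t `^ (- (a / 2)) -
   a * r * sin t ^+ 2 * D r t `^ (- (a / 2) - 1).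
have le_s' t : (1 - a) * S t <= s' t + 8.
  rewrite /s' Sm -/(S t).
  have h1 : a * r * sin t ^+ 2 * (S t / D r t) <= a * S t.
    have -> : a * r * sin t ^+ 2 * (S t / D r t) =
        a * S t * (r * (sin t ^+ 2 / D r t)) by field; rewrite gt_eqF.
    rewrite ler_piMr ?mulr_ge0 ?(ltW a0) //.
    have q0 : 0 <= sin t ^+ 2 / D r t by rewrite divr_ge0 ?sqr_ge0 ?(ltW (D0 t)).
    have q1 : sin t ^+ 2 / D r t <= 1 by rewrite ler_pdivrMr // mul1r.
    nra.
  have h2 : (1 - cos t) * S t <= 8.
    have := ler_wpM2r (S0 t) (cosD t); have := DS t; lra.
  lra.
have sig_le t : `|sigma r a t| <= 4.
  rewrite /sigma normrM [X in _ * X]ger0_norm ?powR_ge0 //.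
  have s12 : `|sin t| <= D r t `^ (2^-1).
    rewrite powR12_sqrt ?(ltW (D0 t)) // -sqrtr_sqr.
    by rewrite ler_sqrt // ltW.
  apply: le_trans (ler_wpM2r (powR_ge0 _ _) s12) _.
  rewrite -powRD; last by apply/implyP => _; rewrite gt_eqF.
  by apply: D4p; lra.
have contD : continuous (D r).
  move=> t; apply: differentiable_continuous; apply/derivable1_diffP.
  by have [] := dD r t.
have contDp (b : R) t : {for t, continuous (fun t => D r t `^ b)}.
  have := is_derive1_comp (is_derive1_powR b (D0 t)) (dD r t).
  by move=> [dp _]; apply: differentiable_continuous; apply/derivable1_diffP.
have cs' : cont_on A B s'.
  move=> t _; apply: cvgB; apply: cvgM; try exact: contDp.
    exact: continuous_cos.
  apply: cvgM; first exact: cvg_cst.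
  by apply: cvgM; exact: continuous_sin.
have cS : cont_on A B S by move=> t _; exact: contDp.
have I1 : rint A B s' = sigma r a B - sigma r a A.
  by apply: rint_FTC => // t _; exact: dsigma.
have -> : rint A B (fun t => nc (1 - polar r t) `^ (- a)) = rint A B S.
  by apply: eq_rint => t _; rewrite -/(N t) DE mulNr.
have a10 : 0 < 1 - a by lra.
rewrite ler_pdivlMr // mulrC -rintZl //.
have c8 : cont_on A B (fun _ : R => 8 : R) by exact: cont_on_cst.
apply: (@le_trans _ _ (rint A B (fun t => s' t + 8))).
  apply: ler_rint => //.
  - by move=> t tt; apply: cvgM; [exact: cvg_cst|exact: cS].
  - by move=> t tt; apply: cvgD; [exact: cs'|exact: c8].
rewrite rintD // I1 rint_cst //.
have := sig_le A; have := sig_le B; rewrite !ler_norml.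
move=> /andP[_ ?] /andP[? _]; lra.
Qed.

End ArcIntegralEstimate.

(** * A function of H^s for all s < 1 with unbounded coefficients *)

Section UnboundedCoefficients.
Context {R : realType}.
Local Notation C := (cplx R).
Local Notation nc := (@Normc.normc R).
Local Notation Re := (@complex.Re R).
Local Notation Im := (@complex.Im R).
Implicit Types (z w : C) (t x e s : R).

(** [lam 0 z] is a branch of [log (2 - z) - log (1 - z)] and [lam j] is its
    [j]-th derivative divided by [j!]. *)
Definition lam (j : nat) (z : C) : C :=
  cauchy_kernel 1 2 (fun=> 1 : C) (fun t => rc t) j z.

Lemma cont_on_rc a b : cont_on a b (fun t => rc t : C).
Proof. by move=> t _; apply: cvg_complex; [exact: cvg_id|exact: cvg_cst]. Qed.

Lemma nc_rc_sub_ge z t : nc z < 1 -> 1 <= t -> 1 - nc z <= nc (rc t - z).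
Proof.
move=> z1 t1; have := ler_ncB (rc t) z; rewrite nc_rc ger0_norm; lra.
Qed.

Lemma has_cderiv_lam j z : nc z < 1 -> has_cderiv (lam j) z (j.+1%:R * lam j.+1 z).
Proof.
move=> z1; have d0 : 0 < 1 - nc z by lra.
apply: (has_cderiv_kernel _ _ j d0).
- exact: cont_on_cst.
- exact: cont_on_rc.
- by move=> t /andP[t1 _]; exact: nc_rc_sub_ge.
Qed.

(** The Taylor coefficients at [z] of [log ((2 - z) / (1 - z)) / (1 - z)]. *)
Fixpoint gcoef (k : nat) (z : C) : C :=
  if k is k'.+1 then (gcoef k' z + lam k z) * (1 - z)^-1
  else lam 0 z * (1 - z)^-1.

Lemma onem_neq0 z : nc z < 1 -> 1 - z != 0.
Proof. by move=> z1; apply/eqP => /subr0_eq E; rewrite -E nc1 ltxx in z1. Qed.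

Lemma has_cderiv_inv_onem z : nc z < 1 ->
  has_cderiv (fun w : C => (1 - w)^-1) z ((1 - z)^-1 * (1 - z)^-1).
Proof.
move=> z1; have n0 := onem_neq0 z1.
have h := has_cderivB (has_cderiv_cst (1 : C) z) (has_cderiv_id z).
have := @has_cderivV _ (fun w : C => 1 - w) z _ n0 h.
by move/has_cderiv_eq; apply; field.
Qed.

(** The recursion defining [gcoef] is the rule of Leibniz for
    [(1 - z) * gcoef 0 z = lam 0 z], divided by [k!]. *)
Lemma has_cderiv_gcoef k z : nc z < 1 ->
  has_cderiv (gcoef k) z (k.+1%:R * gcoef k.+1 z).
Proof.
move=> z1; have hi := has_cderiv_inv_onem z1; have n0 := onem_neq0 z1.
elim: k => [|k IH].
  have := has_cderivM (has_cderiv_lam 0 z1) hi; move/has_cderiv_eq; apply.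
  by rewrite /=; ring.
have := has_cderivM (has_cderivD IH (has_cderiv_lam k.+1 z1)) hi.
move/has_cderiv_eq; apply; rewrite [gcoef k.+2 z]/= -[gcoef k.+1 z]/((gcoef k z + lam k.+1 z) * (1 - z)^-1).
by rewrite -!natr1; ring.
Qed.

Definition gfun (z : C) : C := if nc z < 1 then gcoef 0 z else 0.

Lemma gfunE z : nc z < 1 -> gfun z = lam 0 z * (1 - z)^-1.
Proof. by rewrite /gfun => ->. Qed.

Lemma derive1n_gfun k z : nc z < 1 -> derive1n k gfun z = k`!%:R * gcoef k z.
Proof.
elim: k z => [|k IH] z z1.
  by rewrite /derive1n /= /gfun z1 fact0 mul1r.
rewrite derive1nS; apply: has_cderiv_derive1.
have d0 : 0 < 1 - nc z by lra.
apply: (@has_cderiv_local _ (fun w => k`!%:R * gcoef k w) _ _ _ _ d0).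
  by move=> w wz; rewrite IH //; have := ler_ncB w z; lra.
rewrite factS natrM [_ * k`!%:R]mulrC -mulrA.
exact: has_cderivZ (has_cderiv_gcoef k z1).
Qed.

Lemma gfun_holo : holo_on 1 gfun.
Proof.
move=> z z1; exists (1 * gcoef 1 z).
have d0 : 0 < 1 - nc z by lra.
apply: (@has_cderiv_local _ (gcoef 0) _ _ _ _ d0).
  move=> w wz; rewrite /gfun ifT //; have := ler_ncB w z; lra.
exact: has_cderiv_gcoef.
Qed.

Lemma taylor_coef_gfun k : taylor_coef gfun k = gcoef k 0.
Proof.
have k0 : (k`!%:R : C) != 0 by rewrite -nc_gt0 nc_nat ltr0n fact_gt0.
by rewrite /taylor_coef derive1n_gfun ?nc0 // mulrC mulKf.
Qed.

(** The inequality of Bernoulli for negative exponents. *)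
Lemma inv_pow_ge n t : 1 <= t -> 1 - n%:R * (t - 1) <= t^-1 ^+ n.
Proof.
move=> t1; have t0 : 0 < t by lra.
elim: n => [|n IH]; first by rewrite mul0r subr0 expr0.
have u0 : 0 <= t^-1 by rewrite invr_ge0 ltW.
have u1 : t^-1 <= 1 by rewrite invf_le1.
have u2 : 1 - (t - 1) <= t^-1.
  by rewrite -[X in _ <= X]mul1r ler_pdivlMr //; nra.
have v0 : 0 <= t^-1 ^+ n by rewrite exprn_ge0.
have v1 : t^-1 ^+ n <= 1 by rewrite exprn_ile1.
rewrite exprS -natr1; move: (n%:R : R) IH => m IH; nra.
Qed.

Lemma lam0_ge j : exists2 x, (4 * j.+1%:R)^-1 <= x & lam j 0 = rc x.
Proof.
exists (rint 1 2 (fun t => t^-1 ^+ j.+1)); last first.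
  rewrite /lam /cauchy_kernel (@eq_cint _ _ _ _ (fun t => rc (t^-1 ^+ j.+1))).
    by apply: complexP => //=; rewrite rint_cst ?mul0r //; lra.
  by move=> t _; rewrite mul1r subr0 -rcV -rcX.
have j0 : 0 < j.+1%:R :> R by rewrite ltr0n.
(* on [1, m] the integrand is at least 1/2 *)
pose m : R := 1 + (2 * j.+1%:R)^-1.
have j1 : 1 <= j.+1%:R :> R by rewrite ler1n.
have j20 : 0 < 2 * j.+1%:R :> R by rewrite mulr_gt0.
have j2 : (2 * j.+1%:R)^-1 <= 1 :> R.
  by rewrite invf_le1 //; move: (j.+1%:R : R) j1 => J J1; lra.
have j3 : 0 < (2 * j.+1%:R)^-1 :> R by rewrite invr_gt0.
have m12 : 1 <= m <= 2.
  by rewrite /m; move: (2 * j.+1%:R)^-1 j2 j3 => q q1 q0; lra.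
have ci a b : 0 < a -> cont_on a b (fun t => t^-1 ^+ j.+1).
  move=> a0 t /andP[at_ tb].
  have cV : {for t, continuous (fun t : R => t^-1)}.
    by apply: cvgV; [rewrite gt_eqF // (lt_le_trans a0)|exact: cvg_id].
  exact: (continuous_comp cV (@exprn_continuous R j.+1 _)).
have c12 := ci 1 2 ltr01.
rewrite (rint_cat m12 c12).
have m0 : 0 < m by case/andP: m12 => m1 _; lra.
have H2 : 0 <= rint m 2 (fun t => t^-1 ^+ j.+1).
  apply: rint_ge0 => t /andP[mt _]; rewrite exprn_ge0 // invr_ge0.
  exact: le_trans (ltW m0) mt.
apply: (@le_trans _ _ (rint 1 m (fun=> 2^-1))).
  rewrite rint_cst; last by case/andP: m12.
  have -> : (4 * j.+1%:R)^-1 = 2^-1 * (m - 1) :> R; last by [].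
  rewrite /m addrAC subrr add0r; move: (j.+1%:R : R) j0 => J J0.
  by field; rewrite gt_eqF.
rewrite -[X in X <= _]addr0 lerD //; apply: ler_rint.
- exact: cont_on_cst.
- exact: ci.
move=> t /andP[t1 tm]; apply: le_trans (inv_pow_ge j.+1 t1).
have : j.+1%:R * (t - 1) <= j.+1%:R * (2 * j.+1%:R)^-1.
  by rewrite ler_pM2l // lerBlDl.
rewrite invfM mulrCA divff ?gt_eqF // mulr1; lra.
Qed.

Lemma gcoef0_ge k : exists2 x, 4^-1 * series harmonic k.+1 <= x & gcoef k 0 = rc x.
Proof.
elim: k => [|k [x xS E]].
  have [x xl E] := lam0_ge 0; exists x.
    by rewrite /series /= big_nat1 /harmonic /= -invfM.
  by rewrite /= E subr0 invr1 mulr1.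
have [y yl Ey] := lam0_ge k.+1; exists (x + y).
  by rewrite seriesSr mulrDr; apply: lerD => //; rewrite /harmonic /= -invfM.
by rewrite /= E Ey subr0 invr1 mulr1 rcD.
Qed.

Lemma taylor_coef_gfun_unbounded (M : R) :
  exists k, M < nc (taylor_coef gfun k).
Proof.
apply: contrapT => /forallNP H.
apply: (@dvg_harmonic R); apply: nondecreasing_is_cvgn.
  apply/nondecreasing_seqP => n; rewrite seriesSr lerDl; exact: harmonic_ge0.
exists (Num.max 0 (4 * M)) => _ [[|k] _ <-].
  by rewrite /series /= big_nil le_max lexx.
have [x xl E] := gcoef0_ge k; rewrite le_max; apply/orP; right.
have := H k; rewrite taylor_coef_gfun E nc_rc => /negP; rewrite -leNgt.
have := ler_norm x; lra.
Qed.

Lemma Re_le z : Re z <= nc z.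
Proof. exact: le_trans (ler_norm _) (Re_le_nc z). Qed.

Lemma nc_rc_sub_le z t : nc z < 1 -> 1 <= t ->
  (nc (1 - z) + (t - 1)) / 2 <= nc (rc t - z).
Proof.
move=> z1 t1; have zr := Re_le z.
have h1 : t - 1 <= nc (rc t - z).
  by apply: le_trans (Re_le _); rewrite ReD ReN /=; lra.
have h2 : nc (1 - z) <= nc (rc t - z).
  rewrite -(@ler_pXn2r _ 2) ?nnegrE ?nc_ge0 // !nc2 !ReD !ImD !ReN !ImN /=.
  by nra.
lra.
Qed.

(** As [|t - z| >= (|1 - z| + t - 1) / 2], the integral of [1 / |t - z|] is at most
    [2 ln ((1 + |1 - z|) / |1 - z|)], and [ln y <= y^e / e]. *)
Lemma nc_lam0_le e z : 0 < e -> nc z < 1 ->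
  nc (lam 0 z) <= 4 * 3 `^ e / e * nc (1 - z) `^ (- e).
Proof.
move=> e0 z1; set x := nc (1 - z).
have x0 : 0 < x by rewrite nc_gt0 onem_neq0.
have x2 : x < 2 by have := ncB 1 z; rewrite nc1 -/x; lra.
have nz t : 1 <= t <= 2 -> rc t != z.
  move=> /andP[t1 _]; rewrite -subr_eq0 -nc_gt0.
  by apply: lt_le_trans (nc_rc_sub_ge z1 t1); lra.
have c1 : cont_on 1 2 (fun _ : R => 1 : C) by exact: cont_on_cst.
have cK := cont_kernel (k := 1) c1 (@cont_on_rc 1 2) nz.
apply: le_trans (nc_cint_le cK) _.
pose y t : R := x - 1 + t.
have y0 t : 1 <= t <= 2 -> 0 < y t by move=> /andP[t1 _]; rewrite /y; lra.
have cy : cont_on 1 2 (fun t => 2 * (y t)^-1).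
  move=> t tt; apply: cvgM; first exact: cvg_cst.
  apply: cvgV; first by rewrite gt_eqF // y0.
  by apply: cvgD; [exact: cvg_cst|exact: cvg_id].
have : rint 1 2 (fun t => nc ((1 : C) * (rc t - z)^-1 ^+ 1)) <=
       rint 1 2 (fun t => 2 * (y t)^-1).
  apply: ler_rint => //; first exact: cont_on_nc.
  move=> t tt; have /andP[t1 _] := tt.
  rewrite mul1r expr1 ncV -[2 * _]invf_div lef_pV2 ?posrE ?divr_gt0 ?y0 //.
    by have := nc_rc_sub_le z1 t1; rewrite -/x /y; lra.
  by rewrite nc_gt0 subr_eq0 nz.
have dy t : 1 <= t <= 2 -> is_derive t 1 (fun t => 2 * ln (y t)) (2 * (y t)^-1).
  move=> tt.
  have h := is_deriveD (is_derive_cst (x - 1) t 1) (is_derive_id t 1).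
  have h' := is_deriveZ 2 (is_derive1_comp (is_derive1_ln (y0 t tt)) h).
  by apply: is_derive_eq; rewrite /GRing.scale /= add0r mulr1.
rewrite (rint_FTC _ cy dy); last by lra.
have -> : y 2 = x + 1 by rewrite /y; ring.
have -> : y 1 = x by rewrite /y; ring.
have q0 : 0 < (x + 1) / x by rewrite divr_gt0 //; lra.
have -> : 2 * ln (x + 1) - 2 * ln x = 2 * ln ((x + 1) / x).
  by rewrite ln_div ?posrE //; [rewrite mulrBr|lra].
have p0 : 0 < ((x + 1) / x) `^ e by exact: powR_gt0.
have : e * ln ((x + 1) / x) <= ((x + 1) / x) `^ e.
  rewrite -ln_powR; move: (((x + 1) / x) `^ e) p0 => Y Y0.
  have Y1 : -1 < Y - 1 by lra.
  have := le_ln1Dx Y1; have -> : 1 + (Y - 1) = Y by ring.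
  lra.
have : ((x + 1) / x) `^ e <= 3 `^ e * x `^ (- e).
  rewrite powRM ?invr_ge0 ?(ltW x0) //; last by lra.
  rewrite -powR_inv1 ?(ltW x0) // -powRrM mulN1r ler_wpM2r ?powR_ge0 //.
  by apply: ge0_ler_powR; rewrite ?nnegrE ?(ltW e0) //; lra.
have -> : 4 * 3 `^ e / e * x `^ (- e) = 4 * (e^-1 * (3 `^ e * x `^ (- e))) by ring.
move=> h1 h2 h3.
have : ln ((x + 1) / x) <= e^-1 * (3 `^ e * x `^ (- e)).
  by rewrite ler_pdivlMl //; exact: le_trans h1.
lra.
Qed.

(** The exponent [e] is chosen with [(1 + e) s = (1 + s) / 2 < 1], so that
    [|gfun z|^s] is at most a multiple of [|1 - z|^(- (1 + s) / 2)]. *)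
Lemma gfun_arc_bounded (A B s : R) : A < B -> 0 < s < 1 ->
  exists M, forall r, 0 < r < 1 ->
    rint A B (fun t => nc (gfun (polar r t)) `^ s) <= M.
Proof.
move=> AB s01; have /andP[s0 s1] := s01.
pose e := (1 - s) / (2 * s); have e0 : 0 < e by rewrite divr_gt0 //; lra.
pose a := (1 + s) / 2; have a01 : 0 < a < 1 by rewrite /a; lra.
pose K := 4 * 3 `^ e / e.
have K0 : 0 <= K by rewrite divr_ge0 ?(ltW e0) // mulr_ge0 ?powR_ge0.
exists (K `^ s * ((8 + 8 * (B - A)) / (1 - a))) => r r01.
apply: le_trans (ler_wpM2l (powR_ge0 _ _) (rint_onem_polar_powR (ltW AB) r01 a01)).
have r0 : 0 < r by case/andP: r01.
have c1 : cont_on A B (fun t => nc (1 - polar r t) `^ (- a)).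
  have cc : cont_on A B (fun _ : R => 1 : C) by exact: cont_on_cst.
  have cp : cont_on A B (fun t => polar r t : C) by exact: cont_on_polar.
  have cn : cont_on A B (fun t => nc (1 - polar r t)).
    by apply: cont_on_nc => t tt; exact: (cvgB (cc t tt) (cp t tt)).
  move=> t tt.
  have := is_derive1_powR (- a) (nc_onem_polar_gt0 t r01) => -[dp _].
  apply: (@continuous_comp _ _ _ (fun t => nc (1 - polar r t)) (fun x => x `^ (- a))).
    exact: (cn t tt).
  by apply: differentiable_continuous; apply/derivable1_diffP.
rewrite -rintZl //; apply: ler_rint.
- exact: cont_on_circle_powR gfun_holo r01 s01.
- by move=> t tt; apply: cvgM; [exact: cvg_cst|exact: c1].
move=> t _; have p1 : nc (polar r t) < 1.
  by rewrite nc_polar gtr0_norm //; case/andP: r01.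
have x0 := nc_onem_polar_gt0 t r01.
rewrite (gfunE p1) ncM ncV; set x := nc (1 - polar r t) in x0 *.
have : nc (lam 0 (polar r t)) * x^-1 <= K * x `^ (- (1 + e)).
  have -> : x `^ (- (1 + e)) = x `^ (- e) * x^-1.
    rewrite opprD addrC powRD; last by apply/implyP => _; rewrite gt_eqF.
    by rewrite powR_inv1 // ltW.
  by rewrite mulrA ler_wpM2r ?invr_ge0 ?(ltW x0) // nc_lam0_le.
have -> : x `^ (- a) = (x `^ (- (1 + e))) `^ s.
  by rewrite -powRrM; congr (_ `^ _); rewrite /a /e; field; rewrite gt_eqF.
move=> H; rewrite -powRM ?powR_ge0 //.
apply: ge0_ler_powR H; first exact: ltW.
  by rewrite nnegrE mulr_ge0 ?nc_ge0 ?invr_ge0 ?(ltW x0).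
by rewrite nnegrE mulr_ge0 ?powR_ge0.
Qed.

End UnboundedCoefficients.

(** * Weighted series and arc means *)

Section WeightedSeries.
Context {R : realType}.
Implicit Types (v : nat -> R) (d x : R) (N K m n : nat).

Lemma saturate_bounds x : 0 <= x -> 0 <= x / (1 + x) <= 1.
Proof.
move=> x0; have x1 : 0 < 1 + x by lra.
by rewrite divr_ge0 ?(ltW x1) //= ler_pdivrMr // mul1r; lra.
Qed.

Lemma saturate_le x : 0 <= x -> x / (1 + x) <= x.
Proof.
move=> x0; have x1 : 0 < 1 + x by lra.
by rewrite ler_pdivrMr //; nra.
Qed.

(** The functional [x / (1 + x)] of the metrics detects small values. *)
Lemma saturate_lt x d : 0 <= x -> 0 < d -> x / (1 + x) < d / (1 + d) -> x < d.
Proof.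
move=> x0 d0; have x1 : 0 < 1 + x by lra.
have d1 : 0 < 1 + d by lra.
by rewrite ltr_pdivrMr // mulrAC ltr_pdivlMr //; nra.
Qed.

Lemma tail_sum_le K n :
  \sum_(0 <= i < n) (if (i < K)%N then 0 else 2 ^- i) <=
    2 * 2 ^- K - 2 * 2 ^- (maxn n K) :> R.
Proof.
elim: n => [|n IH]; first by rewrite big_nil max0n subrr.
rewrite big_nat_recr //=; apply: le_trans (lerD IH (lexx _)) _.
have [nK|Kn] := ltnP n K.
  by rewrite addr0 (maxn_idPr nK).
rewrite (maxn_idPl (leqW Kn)) exprSr invfM.
have := exprn_gt0 n (ltr0n R 2); rewrite -invr_gt0; lra.
Qed.

Lemma sum_half_le N n v : (forall n, 0 <= v n) ->
  \sum_(N <= i < n) v i <= \sum_(0 <= i < n) v i.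
Proof.
move=> v0; have [Nn|nN] := leqP N n.
  by rewrite [leRHS](@big_cat_nat _ _ _ N) //= lerDr sumr_ge0.
by rewrite big_geq ?sumr_ge0 // ltnW.
Qed.

Variables (v : nat -> R) (N : nat).
Hypothesis v_bound : forall n, 0 <= v n <= 2 ^- n.

Let v_ge0 n : 0 <= v n. Proof. by case/andP: (v_bound n). Qed.

Let partial_ndecr : nondecreasing_seq (fun n => \sum_(N <= i < n) v i).
Proof.
apply/nondecreasing_seqP => n; have [Nn|nN] := leqP N n.
  by rewrite big_nat_recr //= lerDl.
by rewrite !big_geq // ltnW.
Qed.

Let partial_le d K n : 0 <= d ->
  (forall i, (N <= i < K)%N -> v i <= d * 2 ^- i) ->
  \sum_(N <= i < n) v i <= 2 * d + 2 * 2 ^- K.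
Proof.
move=> d0 H.
pose w i : R := d * 2 ^- i + (if (i < K)%N then 0 else 2 ^- i).
have p0 i : 0 <= 2 ^- i :> R by rewrite invr_ge0 exprn_ge0.
have w0 i : 0 <= w i by rewrite addr_ge0 ?mulr_ge0 //; case: ifP.
apply: (@le_trans _ _ (\sum_(N <= i < n) w i)).
  rewrite big_nat_cond [leRHS]big_nat_cond; apply: ler_sum => i.
  rewrite andbT => /andP[Ni _]; rewrite /w; case: ifP => iK.
    by rewrite addr0; apply: H; rewrite Ni.
  by have := v_bound i; have := mulr_ge0 d0 (p0 i); lra.
apply: le_trans (sum_half_le _ _ w0) _; rewrite big_split /= -mulr_sumr.
have := tail_sum_le K n; have := tail_sum_le 0 n; rewrite maxn0 expr0 invr1 /=.
have := p0 n; have := p0 (maxn n K); move=> h1 h2 h3 h4.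
have h5 : \sum_(0 <= i < n) (2 ^- i : R) <= 2 by lra.
have := ler_wpM2l d0 h5; lra.
Qed.

Lemma is_cvg_weighted : cvgn (fun n => \sum_(N <= i < n) v i).
Proof.
apply: nondecreasing_is_cvgn => //; exists (2 * 1 + 2 * 2 ^- 0) => _ [n _ <-].
by apply: partial_le => // i /andP[_]; rewrite ltn0.
Qed.

Lemma weighted_term_le m : (N <= m)%N ->
  v m <= \big[+%R/0]_(N <= i <oo) v i.
Proof.
move=> Nm; have := nondecreasing_cvgn_le partial_ndecr is_cvg_weighted m.+1.
by apply: le_trans; rewrite big_nat_recr //= lerDr sumr_ge0.
Qed.

Lemma weighted_ge0 : 0 <= \big[+%R/0]_(N <= i <oo) v i.
Proof. exact: le_trans (v_ge0 N) (weighted_term_le (leqnn N)). Qed.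

(** The terms before [K] are small by hypothesis, the others are dominated by a
    geometric tail. *)
Lemma weighted_le d K : 0 <= d ->
  (forall i, (N <= i < K)%N -> v i <= d * 2 ^- i) ->
  \big[+%R/0]_(N <= i <oo) v i <= 2 * d + 2 * 2 ^- K.
Proof.
move=> d0 H; apply: limr_le; first exact: is_cvg_weighted.
by apply: nearW => n; exact: partial_le.
Qed.

End WeightedSeries.

Section ArcMeans.
Context {R : realType}.
Local Notation C := (cplx R).
Local Notation nc := (@Normc.normc R).
Implicit Types (f g h : C -> C) (p A B r c : R).

Lemma unit_discE (z : C) : unit_disc z <-> nc z < 1.
Proof. by rewrite /unit_disc /= norm_nc ltcE /= eqxx. Qed.

Lemma holo_discP f : holo_disc f <->
  holo_on 1 f /\ (forall z, ~ nc z < 1 -> f z = 0).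
Proof.
split=> -[H1 H2]; split=> z.
- by move=> /unit_discE /H1 /derivable_has_cderiv.
- by move=> z1; apply: H2 => /unit_discE.
- by move=> /unit_discE /H1 /derivable_has_cderiv.
- by move=> z1; apply: H2 => /unit_discE.
Qed.

Lemma gfun_holo_disc : holo_disc (@gfun R).
Proof.
apply/holo_discP; split; first exact: gfun_holo.
by move=> z z1; rewrite /gfun ifF //; apply/negP.
Qed.

Lemma holo_discDZ f g (c : C) : holo_disc f -> holo_disc g ->
  holo_disc (fun z => f z + c * g z).
Proof.
move=> /holo_discP[f1 f2] /holo_discP[g1 g2]; apply/holo_discP; split.
  exact: holo_onD f1 (holo_onZ c g1).
by move=> z z1; rewrite f2 // g2 // mulr0 addr0.
Qed.

Lemma holo_discB f g : holo_disc f -> holo_disc g -> holo_disc (f \- g).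
Proof.
move=> hf hg; have := holo_discDZ (-1) hf hg.
by congr holo_disc; apply/funext => z /=; rewrite mulN1r.
Qed.

Definition mean p A B r h : R :=
  (B - A)^-1 * rint A B (fun t => nc (h (polar r t)) `^ p).

Section FixedArc.
Variables (A B p : R).
Hypotheses (AB : A < B) (p01 : 0 < p < 1).

Let BA0 : 0 < (B - A)^-1. Proof. by rewrite invr_gt0 subr_gt0. Qed.

Lemma arc_meanE r h : holo_on 1 h -> 0 < r < 1 ->
  arc_mean p A B r h = (mean p A B r h)%:E.
Proof.
move=> hh r01; rewrite /arc_mean /mean EFinM; congr (_ * _)%E.
have := cont_on_integrable (cont_on_circle_powR (a := A) (b := B) hh r01 p01).
move=> H; have := integrable_fin_num (measurable_segment A B) H.
by move/fineK => <-.
Qed.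

Lemma mean_ge0 r h : 0 <= mean p A B r h.
Proof.
by rewrite mulr_ge0 ?(ltW BA0) //; apply: rint_ge0 => t _; exact: powR_ge0.
Qed.

Lemma arc_sup_le h (M : R) : holo_on 1 h ->
  (forall r, 0 < r < 1 -> mean p A B r h <= M) -> (arc_sup p A B h <= M%:E)%E.
Proof.
move=> hh H; apply: ge_ereal_sup => _ [r r01 <-].
by rewrite arc_meanE // lee_fin; exact: H.
Qed.

Lemma arc_sup_ge0 h : holo_on 1 h -> (0 <= arc_sup p A B h)%E.
Proof.
move=> hh; have r01 : 0 < (2^-1 : R) < 1 by lra.
apply: (@le_trans _ _ (arc_mean p A B 2^-1 h)).
  by rewrite arc_meanE // lee_fin mean_ge0.
by apply: ereal_sup_ubound; exists 2^-1.
Qed.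

Lemma fine_arc_sup_ge0 h : holo_on 1 h -> 0 <= fine (arc_sup p A B h).
Proof. by move=> hh; exact/fine_ge0/arc_sup_ge0. Qed.

Lemma fine_arc_sup_le h (M : R) : holo_on 1 h ->
  (forall r, 0 < r < 1 -> mean p A B r h <= M) ->
  fine (arc_sup p A B h) <= M.
Proof.
move=> hh /(arc_sup_le hh); have := arc_sup_ge0 hh.
by case: (arc_sup p A B h) => [x||].
Qed.

Lemma mean_le_arc_sup r h : holo_on 1 h -> (arc_sup p A B h < +oo)%E ->
  0 < r < 1 -> mean p A B r h <= fine (arc_sup p A B h).
Proof.
move=> hh hfin r01; have h0 := arc_sup_ge0 hh.
rewrite -lee_fin fineK ?ge0_fin_numE // -arc_meanE //.
by apply: ereal_sup_ubound; exists r.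
Qed.

Lemma meanD f g r : holo_on 1 f -> holo_on 1 g -> 0 < r < 1 ->
  mean p A B r (fun z => f z + g z) <= mean p A B r f + mean p A B r g.
Proof.
move=> hf hg r01; rewrite /mean -mulrDr ler_pM2l //.
have cf := cont_on_circle_powR (a := A) (b := B) hf r01 p01.
have cg := cont_on_circle_powR (a := A) (b := B) hg r01 p01.
rewrite -rintD //; apply: ler_rint.
- exact: cont_on_circle_powR (holo_onD hf hg) r01 p01.
- by move=> t tt; exact: (cvgD (cf t tt) (cg t tt)).
move=> t _; apply: le_trans (powR_subadditive (nc_ge0 _) (nc_ge0 _) p01).
apply: ge0_ler_powR; rewrite ?nnegrE ?addr_ge0 ?nc_ge0 ?ncD //.
by case/andP: p01 => /ltW.
Qed.

Lemma meanZ (c : C) f r : holo_on 1 f -> 0 < r < 1 ->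
  mean p A B r (fun z => c * f z) = nc c `^ p * mean p A B r f.
Proof.
move=> hf r01; rewrite /mean mulrCA; congr (_ * _).
rewrite -rintZl; last exact: cont_on_circle_powR hf r01 p01.
by apply: eq_rint => t _; rewrite ncM powRM ?nc_ge0.
Qed.

Lemma gfun_mean_bounded : exists2 M, 0 <= M &
  forall r, 0 < r < 1 -> mean p A B r gfun <= M.
Proof.
have [M HM] := gfun_arc_bounded AB p01.
exists ((B - A)^-1 * M); last first.
  by move=> r r01; rewrite /mean ler_pM2l // HM.
have r01 : 0 < (2^-1 : R) < 1 by lra.
rewrite mulr_ge0 ?(ltW BA0) //; apply: le_trans (HM _ r01).
by apply: rint_ge0 => t _; exact: powR_ge0.
Qed.

Lemma arc_sup_perturb f c : holo_on 1 f -> (arc_sup p A B f < +oo)%E ->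
  (arc_sup p A B (fun z => f z + rc c * gfun z)%R < +oo)%E.
Proof.
move=> hf ffin; have [M M0 HM] := gfun_mean_bounded.
have hg := holo_onZ (rc c) (@gfun_holo R).
apply: (@le_lt_trans _ _ (fine (arc_sup p A B f) + nc (rc c) `^ p * M)%:E).
  apply: arc_sup_le; first exact: holo_onD hf hg.
  move=> r r01; apply: le_trans (meanD hf hg r01) _.
  apply: lerD; first exact: mean_le_arc_sup.
  by rewrite meanZ ?ler_wpM2l ?powR_ge0 ?HM //; exact: gfun_holo.
exact: ltry.
Qed.

Lemma arc_supB_fin f g : holo_on 1 f -> holo_on 1 g ->
  (arc_sup p A B f < +oo)%E -> (arc_sup p A B g < +oo)%E ->
  (arc_sup p A B (f \- g)%R < +oo)%E.
Proof.
move=> hf hg ffin gfin; have hN := holo_onZ (-1) hg.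
have -> : f \- g = (fun z => f z + (-1) * g z).
  by apply/funext => z /=; rewrite mulN1r.
apply: (@le_lt_trans _ _ (fine (arc_sup p A B f) + fine (arc_sup p A B g))%:E).
  apply: arc_sup_le; first exact: holo_onD hf hN.
  move=> r r01; apply: le_trans (meanD hf hN r01) _.
  apply: lerD; first exact: mean_le_arc_sup.
  by rewrite meanZ // ncN nc1 powR1 mul1r; exact: mean_le_arc_sup.
exact: ltry.
Qed.

Lemma perturb_diff f c :
  f \- (fun z => f z + rc c * gfun z) = (fun z : C => - rc c * gfun z).
Proof. by apply/funext => z /=; rewrite opprD addrA subrr add0r mulNr. Qed.

(** Along [c -> 0] the perturbations [f + c g] tend to [f], uniformly in [f]. *)
Lemma fine_arc_sup_perturb (e : R) : 0 < e -> exists2 c0, 0 < c0 &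
  forall f c, 0 < c < c0 ->
    fine (arc_sup p A B (f \- (fun z => f z + rc c * gfun z))%R) <= e.
Proof.
move=> e0; have [M M0 HM] := gfun_mean_bounded.
have /andP[p0 _] := p01.
have M10 : 0 < M + 1 by lra.
have [c0 c00 Hc] := powR_small p0 (divr_gt0 e0 M10).
exists c0 => // f c /andP[c_gt0 cc0]; rewrite perturb_diff.
apply: fine_arc_sup_le; first exact/holo_onZ/gfun_holo.
move=> r r01; rewrite meanZ //; last exact: gfun_holo.
rewrite ncN nc_rc gtr0_norm //.
have c2 : c `^ p <= e / (M + 1) by apply/ltW/Hc; rewrite cc0 ltW.
apply: (@le_trans _ _ (e / (M + 1) * M)).
  by rewrite ler_pM ?powR_ge0 ?mean_ge0 // HM.
by rewrite mulrAC ler_pdivrMr //; nra.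
Qed.

End FixedArc.

End ArcMeans.

(** * The distances of the Hardy spaces *)

Section HardyDistances.
Context {R : realType}.
Local Notation C := (cplx R).
Local Notation nc := (@Normc.normc R).
Implicit Types (f g h : C -> C) (p s A B r c e : R) (n K : nat).

Definition perturb f c : C -> C := fun z => f z + rc c * gfun z.

Lemma disc_sup_ge0 n h : 0 <= disc_sup n h.
Proof.
rewrite /disc_sup; set S := [set _ | _ in _].
(* [sup] returns 0 on sets without a supremum *)
have [hS|hS] := pselect (has_sup S); last by rewrite sup_out.
have [[x Sx] ubS] := hS; have [z _ zx] := Sx.
by apply: le_trans (ub_le_sup ubS Sx); rewrite -zx; exact: nc_ge0.
Qed.

Lemma radius_bounds n : (0 < n)%N -> 0 <= 1 - (n%:R : R)^-1 < 1.
Proof.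
move=> n0; have n1 : 1 <= n%:R :> R by rewrite ler1n.
have n2 : (n%:R)^-1 <= 1 :> R by rewrite invf_le1 // (lt_le_trans ltr01).
have n3 : 0 < (n%:R)^-1 :> R by rewrite invr_gt0 (lt_le_trans ltr01).
lra.
Qed.

Lemma nc_le_disc_sup n h z : (0 < n)%N -> holo_on 1 h ->
  nc z <= 1 - (n%:R)^-1 -> nc (h z) <= disc_sup n h.
Proof.
move=> n0 hh zn; have [M _ HM] := holo_bounded hh (radius_bounds n0).
by apply: ub_le_sup; [exists M => _ [w wn <-]; exact: HM|exists z].
Qed.

Lemma disc_sup_le n h (M : R) : (0 < n)%N ->
  (forall z, nc z <= 1 - (n%:R)^-1 -> nc (h z) <= M) -> disc_sup n h <= M.
Proof.
move=> n0 H; apply: ge_sup => [|_ [z zn <-]]; last exact: H.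
have z0 : nc (0 : C) <= 1 - (n%:R)^-1.
  by rewrite nc0; have /andP[] := radius_bounds n0.
by exists (nc (h 0)); exists 0.
Qed.

Lemma pow_half_saturate n (x : R) : 0 <= x ->
  0 <= 2 ^- n * (x / (1 + x)) <= 2 ^- n.
Proof.
move=> x0; have /andP[w0 w1] := saturate_bounds x0.
have p0 : 0 <= 2 ^- n :> R by rewrite invr_ge0 exprn_ge0.
by rewrite mulr_ge0 //= ler_piMr.
Qed.

Lemma disc_series_bound h n :
  0 <= 2 ^- n * (disc_sup n h / (1 + disc_sup n h)) <= 2 ^- n.
Proof. exact/pow_half_saturate/disc_sup_ge0. Qed.

Lemma dist_HpAB_ge0 A B p f g : A < B -> 0 < p < 1 ->
  holo_on 1 (f \- g) -> 0 <= dist_HpAB p A B f g.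
Proof.
move=> AB p01 hfg; apply: addr_ge0; first exact: fine_arc_sup_ge0.
by apply: weighted_ge0 => n; exact: disc_series_bound.
Qed.

Lemma common_threshold (P : nat -> R -> Prop) :
  (forall n, exists2 c0, 0 < c0 & forall c, 0 < c < c0 -> P n c) ->
  forall K, exists2 c0, 0 < c0 & forall c, 0 < c < c0 ->
    forall n, (n < K)%N -> P n c.
Proof.
move=> H; elim=> [|K [c0 c00 Hc0]]; first by exists 1.
have [c1 c10 Hc1] := H K; exists (Num.min c0 c1); first by rewrite lt_min c00.
move=> c /andP[c_gt0]; rewrite lt_min => /andP[cc0 cc1] n.
rewrite ltnS leq_eqVlt => /predU1P[->|]; first by apply: Hc1; rewrite c_gt0.
by apply: Hc0; rewrite c_gt0.
Qed.

Lemma disc_sup_perturb n e : (0 < n)%N -> 0 < e ->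
  exists2 c0, 0 < c0 & forall c, 0 < c < c0 ->
    forall f, disc_sup n (f \- perturb f c) <= e.
Proof.
move=> n0 e0; have [M M0 HM] := holo_bounded (@gfun_holo R) (radius_bounds n0).
have M10 : 0 < M + 1 by lra.
exists (e / (M + 1)); first exact: divr_gt0.
move=> c /andP[c0 ce] f; rewrite perturb_diff; apply: disc_sup_le => // z zn.
rewrite ncM ncN nc_rc gtr0_norm //.
move: ce; rewrite ltr_pdivlMr //; have := HM z zn; have := nc_ge0 (gfun z); nra.
Qed.

(** A single threshold for [c] handles the arc mean and the finitely many terms of
    the series that exceed the geometric tail. *)
Lemma dist_HpAB_perturb A B p e : A < B -> 0 < p < 1 -> 0 < e ->
  exists2 c0, 0 < c0 & forall c, 0 < c < c0 ->
    forall f, dist_HpAB p A B f (perturb f c) <= e.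
Proof.
move=> AB p01 e0.
have e2 : 0 < e / 2 by rewrite divr_gt0.
have e8 : 0 < e / 8 by rewrite divr_gt0.
have e4 : 0 < e / 4 by rewrite divr_gt0.
have [K HK] := half_pow_small 2 e4.
have [c1 c10 Hc1] := fine_arc_sup_perturb AB p01 e2.
have [c2 c20 Hc2] : exists2 c2, 0 < c2 & forall c, 0 < c < c2 ->
    forall n, (n < K)%N -> (0 < n)%N ->
    forall f, disc_sup n (f \- perturb f c) <= e / 8.
  apply: common_threshold => -[|n]; first by exists 1.
  have [c2 c20 Hc2] := disc_sup_perturb (ltn0Sn n) e8.
  by exists c2 => // c cc _; exact: Hc2.
exists (Num.min c1 c2); first by rewrite lt_min c10.
move=> c /andP[c0]; rewrite lt_min => /andP[cc1 cc2] f.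
have h1 : fine (arc_sup p A B (f \- perturb f c)) <= e / 2.
  by apply: Hc1; rewrite c0.
have h2 : \big[+%R/0]_(2 <= n <oo) (2 ^- n * (disc_sup n (f \- perturb f c) /
    (1 + disc_sup n (f \- perturb f c)))) <= 2 * (e / 8) + 2 * 2 ^- K.
  apply: weighted_le; first by move=> n; exact: disc_series_bound.
    exact: ltW.
  move=> n /andP[n2 nK]; rewrite mulrC ler_wpM2r ?invr_ge0 ?exprn_ge0 //.
  apply: le_trans (saturate_le (disc_sup_ge0 _ _)) _.
  by apply: Hc2; rewrite ?c0 // (leq_trans _ n2).
rewrite /dist_HpAB; lra.
Qed.

Lemma dist_capHAB_perturb (q : nat -> R) A B e : A < B ->
  (forall n, 0 < q n < 1) -> 0 < e ->
  exists2 c0, 0 < c0 & forall c, 0 < c < c0 ->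
    forall f, holo_disc f -> dist_capHAB q A B f (perturb f c) <= e.
Proof.
move=> AB q01 e0.
have e8 : 0 < e / 8 by rewrite divr_gt0.
have e4 : 0 < e / 4 by rewrite divr_gt0.
have [K HK] := half_pow_small 2 e4.
have [c0 c00 Hc] : exists2 c0, 0 < c0 & forall c, 0 < c < c0 ->
    forall n, (n < K)%N ->
    forall f, dist_HpAB (q n) A B f (perturb f c) <= e / 8.
  by apply: common_threshold => n; exact: dist_HpAB_perturb.
exists c0 => // c cc f hf.
have d0 n : 0 <= dist_HpAB (q n) A B f (perturb f c).
  apply: dist_HpAB_ge0 => //; rewrite perturb_diff.
  exact/holo_onZ/gfun_holo.
have p0 n : 0 <= 2 ^- n :> R by rewrite invr_ge0 exprn_ge0.
have pS n : 2 ^- n.+1 <= 2 ^- n :> R.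
  rewrite exprS invfM; have := p0 n; lra.
rewrite /dist_capHAB.
apply: (@le_trans _ _ (2 * (e / 8) + 2 * 2 ^- K)); last lra.
apply: weighted_le.
- move=> n; have /andP[w0 w1] := pow_half_saturate n.+1 (d0 n).
  by rewrite w0 (le_trans w1).
- exact: ltW.
move=> n /andP[_ nK]; rewrite mulrC.
have w0 : 0 <= dist_HpAB (q n) A B f (perturb f c) /
    (1 + dist_HpAB (q n) A B f (perturb f c)).
  by have /andP[] := saturate_bounds (d0 n).
have w1 := le_trans (saturate_le (d0 n)) (Hc c cc n nK f).
exact: (ler_pM w0 (p0 n.+1) w1 (pS n)).
Qed.

(** The term of index 2 of the metric is the supremum over the disc of radius
    1/2. *)
Lemma disc_small_of_dist_HpAB A B p e : A < B -> 0 < p < 1 -> 0 < e ->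
  exists2 d, 0 < d & forall f g, holo_on 1 (f \- g) ->
    dist_HpAB p A B f g < d -> forall z, nc z <= 4^-1 -> nc (f z - g z) <= e.
Proof.
move=> AB p01 e0.
have w0 : 0 < e / (1 + e) by rewrite divr_gt0 //; lra.
have p20 : 0 < 2 ^- 2 :> R by rewrite invr_gt0 exprn_gt0.
exists (2 ^- 2 * (e / (1 + e))); first by rewrite mulr_gt0.
move=> f g hfg dfg z z4.
have n20 : (0 < 2)%N by [].
have z2 : nc z <= 1 - (2%:R)^-1 by lra.
apply: le_trans (nc_le_disc_sup n20 hfg z2) _.
apply/ltW/saturate_lt => //; first exact: disc_sup_ge0.
rewrite -(ltr_pM2l p20); apply: le_lt_trans dfg.
have := weighted_term_le (N := 2) (disc_series_bound (f \- g)) (leqnn 2).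
rewrite /dist_HpAB; have := fine_arc_sup_ge0 AB p01 hfg; lra.
Qed.

Lemma dist_HpAB_of_dist_capHAB (q : nat -> R) A B e : A < B ->
  (forall n, 0 < q n < 1) -> 0 < e ->
  exists2 d, 0 < d & forall f g, holo_on 1 (f \- g) ->
    dist_capHAB q A B f g < d -> dist_HpAB (q 0%N) A B f g < e.
Proof.
move=> AB q01 e0.
have w0 : 0 < e / (1 + e) by rewrite divr_gt0 //; lra.
have p20 : 0 < 2 ^- 1 :> R by rewrite invr_gt0 exprn_gt0.
exists (2 ^- 1 * (e / (1 + e))); first by rewrite mulr_gt0.
move=> f g hfg dfg.
have d0 n : 0 <= dist_HpAB (q n) A B f g by exact: dist_HpAB_ge0.
apply: saturate_lt => //; rewrite -(ltr_pM2l p20); apply: le_lt_trans dfg.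
have p0 n : 0 <= 2 ^- n :> R by rewrite invr_ge0 exprn_ge0.
pose v n : R := 2 ^- n.+1 * (dist_HpAB (q n) A B f g / (1 + dist_HpAB (q n) A B f g)).
have vb n : 0 <= v n <= 2 ^- n.
  have /andP[a0 a1] := pow_half_saturate n.+1 (d0 n).
  rewrite a0 (le_trans a1) // exprS invfM; have := p0 n; lra.
exact: (weighted_term_le (N := 0) vb (leqnn 0)).
Qed.

(** This is the argument of Hardy and Littlewood, applied to [f - g]. *)
Lemma disc_small_of_dist_Hp p e : 0 < p < 1 -> 0 < e ->
  exists2 d, 0 < d & forall f g, Hp p f -> Hp p g ->
    dist_Hp p f g < d -> forall z, nc z <= 4^-1 -> nc (f z - g z) <= e.
Proof.
move=> p01 e0; have P0 : 0 < 2 * pi :> R := two_pi_gt0.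
have [d d0 Hd] := holo_small_on_quarter p01 e0.
exists (d / (2 * pi)); first exact: divr_gt0.
move=> f g [/holo_discP[hf _] ffin] [/holo_discP[hg _] gfin] dfg z z4.
have hfg : holo_on 1 (f \- g).
  move=> w w1; have [l Hl] := hf w w1; have [m Hm] := hg w w1.
  by exists (l - m); exact: has_cderivB.
apply: (Hd (f \- g) hfg _ z z4) => r r01.
have := mean_le_arc_sup P0 p01 hfg (arc_supB_fin P0 p01 hf hg ffin gfin) r01.
move=> /le_lt_trans /(_ dfg) /ltW; rewrite /mean subr0 mulrC.
by rewrite ler_pM2r // invr_gt0.
Qed.

End HardyDistances.

(** * The sets are G-delta and dense *)

Section GenericCoefficients.
Context {R : realType}.
Local Notation C := (cplx R).
Local Notation nc := (@Normc.normc R).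
Implicit Types (f g h : C -> C) (c e : R) (n k : nat).

Lemma not_ell_inftyP (u : nat -> C) :
  ~ ell_infty u <-> forall M : R, exists k, M < nc (u k).
Proof.
split=> [H M|H].
  apply: contrapT => /forallNP uM; apply: H; exists (rc M); split.
    by apply/complex_realP; exists M.
  move=> x Mx k _ /=; rewrite norm_nc; apply: le_trans (ltW Mx).
  by rewrite lecE /= eqxx /= leNgt; apply/negP; exact: uM.
move=> [M [/complex_realP[m ->] HM]]; have [k mk] := H (m + 1).
have /HM : (real_complex R m : C) < rc (m + 1) by rewrite ltcE /= eqxx ltrDl ltr01.
by move=> /(_ k I) /=; rewrite norm_nc lecE /= eqxx /= leNgt mk.
Qed.

Lemma taylor_coef_derive n f k : taylor_coef (derive1n n f) k =
  rc ((n + k)`!%:R / k`!%:R) * taylor_coef f (n + k).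
Proof.
have nk0 m : (m`!%:R : C) != 0 by rewrite -nc_gt0 nc_nat ltr0n fact_gt0.
rewrite /taylor_coef /derive1n -iterD addnC rcM rcV !rc_nat.
by field; rewrite !nk0.
Qed.

Lemma fact_ratio_ge1 n k : 1 <= (n + k)`!%:R / k`!%:R :> R.
Proof.
rewrite ler_pdivlMr ?ltr0n ?fact_gt0 // mul1r ler_nat.
elim: n => //= n IH; rewrite addSn factS; apply: leq_trans IH _.
by rewrite leq_pmull.
Qed.

Lemma nc_taylor_coef_derive n f k :
  nc (taylor_coef (derive1n n f) k) =
    (n + k)`!%:R / k`!%:R * nc (taylor_coef f (n + k)).
Proof.
by rewrite taylor_coef_derive ncM nc_rc ger0_norm.
Qed.

Lemma taylor_coefB f g k : holo_on 1 f -> holo_on 1 g ->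
  taylor_coef (f \- g) k = taylor_coef f k - taylor_coef g k.
Proof.
move=> hf hg; rewrite -[X in _ - X]mul1r -mulNr -taylor_coefDZ //.
by congr (taylor_coef _ _); apply/funext => z /=; rewrite mulN1r.
Qed.

Lemma gfun_coef_unbounded_from n (M : R) :
  exists k, M < nc (taylor_coef gfun (n + k)).
Proof.
pose S : R := \sum_(i < n) nc (taylor_coef gfun i).
have S0 : 0 <= S by apply: sumr_ge0 => i _; exact: nc_ge0.
have [k Hk] := @taylor_coef_gfun_unbounded R (Num.max M 0 + S).
have nk : (n <= k)%N.
  rewrite leqNgt; apply/negP => kn.
  have : nc (taylor_coef gfun k) <= S.
    rewrite /S (bigD1 (Ordinal kn)) //= lerDl.
    by apply: sumr_ge0 => i _; exact: nc_ge0.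
  have : 0 <= Num.max M 0 by rewrite le_max lexx orbT.
  lra.
exists (k - n)%N; rewrite subnKC //.
have : M <= Num.max M 0 by rewrite le_max lexx.
lra.
Qed.

(** What the argument uses of the three spaces: their distance controls the
    supremum on a small disc, and adding a suitable multiple of [gfun] moves [f]
    by an arbitrarily small distance within the space. *)
Definition hardy_like (X : set (C -> C)) (d : (C -> C) -> (C -> C) -> R) :=
  [/\ forall f, X f -> holo_disc f,
      forall e, 0 < e -> exists2 r, 0 < r & forall f g, X f -> X g ->
        d f g < r -> forall z, nc z <= 4^-1 -> nc (f z - g z) <= e &
      forall f e, X f -> 0 < e -> exists c, [/\ 0 < c, X (perturb f c) &
        d f (perturb f c) < e]].

Section Space.
Variables (X : set (C -> C)) (d : (C -> C) -> (C -> C) -> R).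
Hypothesis Xd : hardy_like X d.

Let holoX f : X f -> holo_on 1 f.
Proof. by case: Xd => H _ _ /H /holo_discP[]. Qed.

(** By the estimates of Cauchy, [beta_(n+k)] is continuous for the distance. *)
Lemma open_coef_gt n (M : R) : open
  [set f : dist_space X d |
    exists k, M < nc (taylor_coef (derive1n n (sval f)) k)].
Proof.
suff : dist_open [set f : dist_space X d |
    exists k, M < nc (taylor_coef (derive1n n (sval f)) k)] by [].
case: Xd => _ Xsmall _ [f Xf] /= [k]; rewrite nc_taylor_coef_derive => Mk.
set rho := (_ / _ : R) in Mk; set L := nc (taylor_coef f (n + k)) in Mk.
have rho0 : 0 < rho := lt_le_trans ltr01 (fact_ratio_ge1 n k).
have r4 : 0 < (4^-1 : R) < 1 by lra.
have [K K0 HK] := nc_taylor_coef_le (n + k) r4.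
have ML : M / rho < L by rewrite ltr_pdivrMr // mulrC.
have e0 : 0 < (L - M / rho) / (2 * K) by rewrite divr_gt0 ?subr_gt0 ?mulr_gt0.
have [r r0 Hr] := Xsmall _ e0; exists r => // -[g Xg] /= dfg.
exists k; rewrite nc_taylor_coef_derive -/rho mulrC -ltr_pdivrMr //.
have hfg : holo_on 1 (f \- g).
  move=> w w1; have [l Hl] := holoX Xf w1; have [m Hm] := holoX Xg w1.
  by exists (l - m); exact: has_cderivB.
have := HK _ _ hfg (Hr f g Xf Xg dfg); rewrite taylor_coefB; [|exact: holoX..].
have -> : K * ((L - M / rho) / (2 * K)) = (L - M / rho) / 2.
  by field; rewrite gt_eqF // gt_eqF.
have := ler_ncB (taylor_coef f (n + k)) (taylor_coef g (n + k)); rewrite -/L.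
lra.
Qed.

Lemma Gdelta_unbounded_coef n : Gdelta
  [set f : dist_space X d | ~ ell_infty (taylor_coef (derive1n n (sval f)))].
Proof.
exists (fun i : nat => [set f : dist_space X d |
    exists k, i%:R < nc (taylor_coef (derive1n n (sval f)) k)]).
  by move=> i; exact: open_coef_gt.
apply/seteqP; split=> f /=.
  by move=> /not_ell_inftyP H i _; exact: H.
move=> H; apply/not_ell_inftyP => M.
have [k Hk] := H (Num.bound `|M|) I; exists k; apply: le_lt_trans Hk.
by apply: le_trans (ler_norm _) _; apply/ltW/archi_boundP.
Qed.

(** If [f0] has bounded coefficients then [f0 + c g] has unbounded ones, for every
    [c > 0]. *)
Lemma dense_unbounded_coef n : dense
  [set f : dist_space X d | ~ ell_infty (taylor_coef (derive1n n (sval f)))].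
Proof.
move=> O [f0 Of0] oO; have oO' : dist_open O by exact: oO.
have [bf0|] := pselect (ell_infty (taylor_coef (derive1n n (sval f0)))); last first.
  by exists f0.
have [e e0 He] := oO' f0 Of0; case: Xd => _ _ Xpert.
have [c [c0 Xc dc]] := Xpert _ _ (svalP f0) e0.
exists (exist _ _ Xc); split; first exact: He.
apply/not_ell_inftyP => M.
have [m Hm] : exists m : R, forall k,
    nc (taylor_coef (derive1n n (sval f0)) k) <= m.
  apply: contrapT => /forallNP H; move: bf0; apply/not_ell_inftyP => m.
  by have /existsNP[k /negP] := H m; rewrite -ltNge; exists k.
have [k Hk] := gfun_coef_unbounded_from n ((`|M| + m) / c).
exists k; rewrite /sval; set ratio := ((n + k)`!%:R / k`!%:R : R).
have ratio1 : 1 <= ratio := fact_ratio_ge1 n k.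
have := Hm k; rewrite !nc_taylor_coef_derive -/ratio.
have -> : taylor_coef (perturb (sval f0) c) (n + k) =
    taylor_coef (sval f0) (n + k) + rc c * taylor_coef gfun (n + k).
  by apply: taylor_coefDZ; [exact: holoX (svalP f0)|exact: gfun_holo].
set u := taylor_coef (sval f0) _; set v := taylor_coef gfun _ in Hk *.
move=> um; have m0 : 0 <= m.
  by apply: le_trans um; rewrite mulr_ge0 ?nc_ge0 // (le_trans ler01).
have Mm : `|M| + m < nc (rc c * v).
  by rewrite ncM nc_rc (gtr0_norm c0) mulrC -ltr_pdivrMr.
have tri : nc (rc c * v) <= nc (u + rc c * v) + nc u.
  by have := ncB (u + rc c * v) u; rewrite addrAC subrr add0r.
have M0 := normr_ge0 M; have MM := ler_norm M; have u0 := nc_ge0 u.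
move: (nc (rc c * v)) (nc (u + rc c * v)) (nc u) Mm tri u0 um => V W U Mm tri u0 um.
have h1 : ratio * (`|M| + m) < ratio * (W + U).
  by rewrite ltr_pM2l ?(lt_le_trans ltr01) // (lt_le_trans Mm).
have h2 : `|M| + m <= ratio * (`|M| + m) by rewrite ler_peMl // addr_ge0.
rewrite mulrDr in h1; lra.
Qed.

End Space.

End GenericCoefficients.

Section HardySpaces.
Context {R : realType}.
Local Notation C := (cplx R).
Local Notation nc := (@Normc.normc R).

Lemma holo_disc_perturb (f : C -> C) c : holo_disc f -> holo_disc (perturb f c).
Proof. by move=> hf; exact: holo_discDZ hf gfun_holo_disc. Qed.

Lemma holo_onB_disc (f g : C -> C) : holo_disc f -> holo_disc g ->
  holo_on 1 (f \- g).
Proof. by move=> hf hg; have /holo_discP[] := holo_discB hf hg. Qed.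

Lemma HpAB_perturb (p A B c : R) f : A < B -> 0 < p < 1 ->
  HpAB p A B f -> HpAB p A B (perturb f c).
Proof.
move=> AB p01 [hf ffin]; split; first exact: holo_disc_perturb.
by apply: arc_sup_perturb => //; case/holo_discP: hf.
Qed.

Lemma half_lt (x : R) : 0 < x -> 0 < x / 2 < x.
Proof. by move=> x0; apply/andP; split; lra. Qed.

Lemma hardy_like_Hp (p : R) : 0 < p < 1 -> hardy_like (Hp p) (dist_Hp p).
Proof.
move=> p01; split; first by move=> f [].
  by move=> e e0; exact: disc_small_of_dist_Hp.
move=> f e Xf e0; have /andP[e20 e2] := half_lt e0.
have [c0 c00 Hc] := fine_arc_sup_perturb (@two_pi_gt0 R) p01 e20.
exists (c0 / 2); have cc := half_lt c00; have /andP[c20 _] := cc.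
split; first exact: c20.
  exact: (HpAB_perturb (c0 / 2) (@two_pi_gt0 R) p01 Xf).
exact: le_lt_trans (Hc f _ cc) e2.
Qed.

Lemma hardy_like_HpAB (p A B : R) : A < B -> 0 < p < 1 ->
  hardy_like (HpAB p A B) (dist_HpAB p A B).
Proof.
move=> AB p01; split; first by move=> f [].
  move=> e e0; have [r r0 Hr] := disc_small_of_dist_HpAB AB p01 e0.
  exists r => // f g [hf _] [hg _]; apply: Hr.
  exact: holo_onB_disc.
move=> f e Xf e0; have /andP[e20 e2] := half_lt e0.
have [c0 c00 Hc] := dist_HpAB_perturb AB p01 e20.
exists (c0 / 2); have cc := half_lt c00; have /andP[c20 _] := cc.
split; [exact: c20|exact: HpAB_perturb|].
exact: le_lt_trans (Hc _ cc f) e2.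
Qed.

Lemma hardy_like_capHAB (q : nat -> R) (A B : R) : A < B ->
  (forall n, 0 < q n < 1) -> hardy_like (capHAB A B) (dist_capHAB q A B).
Proof.
move=> AB q01.
have holo f : capHAB A B f -> holo_disc f by move=> /(_ _ (q01 0%N)) [].
split; first exact: holo.
  move=> e e0; have [r r0 Hr] := disc_small_of_dist_HpAB AB (q01 0%N) e0.
  have [r' r'0 Hr'] := dist_HpAB_of_dist_capHAB AB q01 r0.
  exists r'; first exact: r'0.
  move=> f g /holo hf /holo hg dfg.
  have hfg := holo_onB_disc hf hg.
  exact: Hr hfg (Hr' _ _ hfg dfg).
move=> f e Xf e0; have /andP[e20 e2] := half_lt e0.
have [c0 c00 Hc] := dist_capHAB_perturb AB q01 e20.
exists (c0 / 2); have cc := half_lt c00; have /andP[c20 _] := cc.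
split; first exact: c20.
  by move=> s s01; exact: HpAB_perturb AB s01 (Xf s s01).
exact: le_lt_trans (Hc _ cc f (holo f Xf)) e2.
Qed.

End HardySpaces.

Theorem mainTheorem3 (R : realType) (A B p : R) (q : nat -> R)
    (hAB : A < B) (hp : 0 < p < 1)
    (hq01 : forall n : nat, 0 < q n < 1)
    (hq_incr : forall m n : nat, (m < n)%N -> q m < q n)
    (hq_lim : q @ \oo --> (1 : R))
    (X : set (cplx R -> cplx R))
    (d : (cplx R -> cplx R) -> (cplx R -> cplx R) -> R)
    (hX : [\/ X = Hp p /\ d = dist_Hp p,
              X = HpAB p A B /\ d = dist_HpAB p A B |
              X = capHAB A B /\ d = dist_capHAB q A B]) :
  (Gdelta [set f : dist_space X d | ~ ell_infty (taylor_coef (sval f))] /\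
   dense [set f : dist_space X d | ~ ell_infty (taylor_coef (sval f))]) /\
  (forall n : nat,
     Gdelta [set f : dist_space X d |
              ~ ell_infty (taylor_coef (derive1n n (sval f)))] /\
     dense [set f : dist_space X d |
              ~ ell_infty (taylor_coef (derive1n n (sval f)))]).
Proof.
have Xd : hardy_like X d.
  case: hX => -[-> ->].
  - exact: hardy_like_Hp.
  - exact: hardy_like_HpAB.
  - exact: hardy_like_capHAB.
have H n := conj (Gdelta_unbounded_coef Xd n) (dense_unbounded_coef Xd n).
by split; [exact: (H 0%N)|exact: H].
Qed.
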